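(* For every $t \in \mathbb{N}$, $$N_{S^3}(2t) \leq (2t+1)\, N_{S^2}(t) \quad\text{and}\quad N_{S^3}(2t+1) \leq 2(t+1)\, N_{S^2}(t).$$
   Context: Let $\mu_{S^d}$ be the spherical (surface) measure on the unit sphere $S^d \subset \mathbb{R}^{d+1}$ and $|S^d| = \mu_{S^d}(S^d)$. A finite (nonempty) subset $X \subset S^d$ is a $t$-design on $S^d$ if $\frac{1}{|X|}\sum_{x\in X} f(x) = \frac{1}{|S^d|}\int_{S^d} f \, d\mu_{S^d}$ for every function $f$ on $S^d$ that is the restriction of a polynomial function on $\mathbb{R}^{d+1}$ (complex coefficients) of degree at most $t$. $N_{S^d}(t)$ denotes the smallest cardinality of a $t$-design on $S^d$ (it is known that $t$-designs on $S^d$ exist for all $t$ and all $d \geq 1$). *)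

(* Defs.v *)
From HB Require Import structures.
From mathcomp Require Import all_boot all_order all_algebra finmap.
(* The notations of mpoly clash with those of all_analysis. *)
From mathcomp Require Import -(notations) mpoly.
From mathcomp Require Import all_classical all_reals all_analysis.
From mathcomp Require Import measurable_realfun complex.

Set Implicit Arguments.
Unset Strict Implicit.
Unset Printing Implicit Defensive.
Import Order.TTheory GRing.Theory Num.Theory.
Import numFieldNormedType.Exports.
Local Open Scope classical_set_scope.
Local Open Scope complex_scope.
Local Open Scope ring_scope.

(* Tuples, unlike row vectors, carry the product (Borel) sigma-algebra. *)
Notation euclid R n := (n.-tuple (measurableTypeR R)).

Definition cons_pair (R : realType) (n : nat)
    (p : measurableTypeR R * euclid R n) : euclid R n.+1 :=
  [the n.+1.-tuple (measurableTypeR R) of p.1 :: p.2].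

Definition enorm (R : realType) (n : nat) (x : euclid R n) : R :=
  Num.sqrt (\sum_(i < n) tnth x i ^+ 2).

(* x / |x|; the value at the origin is the origin *)
Definition radial_proj (R : realType) (n : nat) (x : euclid R n) : euclid R n :=
  [tuple (tnth x i / enorm x : measurableTypeR R) | i < n].

Lemma measurable_cons_pair (R : realType) (n : nat) :
  measurable_fun [set: _] (@cons_pair R n).
Proof. exact: measurable_cons. Qed.

Lemma measurable_enorm (R : realType) (n : nat) :
  measurable_fun [set: euclid R n] (@enorm R n).
Proof.
rewrite (_ : @enorm R n =
    fun x : euclid R n => (\sum_(i < n) tnth x i ^+ 2) `^ 2^-1).
  apply: (@measurableT_comp _ _ _ _ _ _ (@powR R ^~ 2^-1)).
    exact: measurable_powR.
  by apply: measurable_sum => i; apply: measurable_funX; exact: measurable_tnth.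
by apply/funext => x; rewrite powR12_sqrt// sumr_ge0// => i _; exact: sqr_ge0.
Qed.

Lemma measurable_radial_proj (R : realType) (n : nat) :
  measurable_fun [set: euclid R n] (@radial_proj R n).
Proof.
apply/measurable_fun_tnthP => i.
rewrite (_ : _ \o _ = fun x : euclid R n => tnth x i * (enorm x `^ (-1))).
  apply: measurable_funM; first exact: measurable_tnth.
  apply: (@measurableT_comp _ _ _ _ _ _ (@powR R ^~ (-1))).
    exact: measurable_powR.
  exact: measurable_enorm.
by apply/funext => x /=; rewrite tnth_mktuple powR_inv1// sqrtr_ge0.
Qed.

Section cons_measure.
Local Open Scope ereal_scope.
Variables (R : realType) (n : nat).
Variable m : {sigma_finite_measure set (euclid R n) -> \bar R}.

Definition cons_measure : set (euclid R n.+1) -> \bar R :=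
  pushforward (lebesgue_measure \x m) (@cons_pair R n).

Let mcons := isMeasurableFun.Build _ _ _ _ _ (@measurable_cons_pair R n).
Let cons_pack : {mfun _ >-> _} := HB.pack (@cons_pair R n) mcons.

Let cons_measure0 : cons_measure set0 = 0.
Proof. by rewrite /cons_measure /pushforward preimage_set0 measure0. Qed.

Let cons_measure_ge0 A : 0 <= cons_measure A.
Proof. exact: (@measure_ge0 _ _ _ (pushforward _ cons_pack)). Qed.

Let cons_measure_sigma_additive : semi_sigma_additive cons_measure.
Proof. exact: (@measure_semi_sigma_additive _ _ _ (pushforward _ cons_pack)). Qed.

HB.instance Definition _ := isMeasure.Build _ _ _ cons_measure
  cons_measure0 cons_measure_ge0 cons_measure_sigma_additive.

Let cons_measure_sigma_finite : sigma_finite setT cons_measure.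
Proof.
have /sigma_finiteP[F [TF ndF Foo]] := sigma_finiteT (@lebesgue_measure R).
have /sigma_finiteP[G [TG ndG Goo]] := sigma_finiteT m.
pose uncons (t : euclid R n.+1) : measurableTypeR R * euclid R n :=
  (tnth t ord0, [tuple of behead t]).
have muncons : measurable_fun setT uncons.
  apply/measurable_fun_pairP; split; first exact: measurable_tnth.
  exact: measurable_behead.
have consK (p : measurableTypeR R * euclid R n) : uncons (cons_pair p) = p.
  by case: p => x y; congr pair; apply/val_inj.
exists (fun k => uncons @^-1` (F k `*` G k)).
  rewrite -preimage_bigcup -[LHS](preimage_setT uncons); congr preimage.
  apply/seteqP; split=> // -[x y] _ /=.
  have [k _ Fkx] : (\bigcup_k F k) x by rewrite -TF.
  have [l _ Gly] : (\bigcup_k G k) y by rewrite -TG.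
  exists (maxn k l) => //; split => /=.
    by move: x Fkx; exact/subsetPset/ndF/leq_maxl.
  by move: y Gly; exact/subsetPset/ndG/leq_maxr.
move=> k; have [mF Fk] := Foo k; have [mG Gk] := Goo k; split.
  by rewrite -[X in measurable X]setTI; apply: muncons => //; exact: measurableX.
rewrite /cons_measure /pushforward.
rewrite (_ : @cons_pair R n @^-1` (uncons @^-1` _) = F k `*` G k).
  by rewrite product_measure1E// lte_mul_pinfty// ge0_fin_numE.
by rewrite -comp_preimage (_ : _ \o _ = id)//; apply/funext => p; exact: consK.
Qed.

HB.instance Definition _ := @Measure_isSigmaFinite.Build _ _ _
  cons_measure cons_measure_sigma_finite.

End cons_measure.

(* Lebesgue measure on R^n, as an iterated product *)
Fixpoint lebesgue_euclid (R : realType) (n : nat) :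
    {sigma_finite_measure set (euclid R n) -> \bar R} :=
  match n with
  | 0 => \d_([tuple] : euclid R 0)
  | n'.+1 => cons_measure (lebesgue_euclid R n')
  end.

Definition sphere (R : realType) (d : nat) : set (euclid R d.+1) :=
  [set x | enorm x = 1].

(* Surface measure on S^d, carried by R^(d+1), from polar coordinates:
   (d + 1) times the Lebesgue measure of the cone over A in the unit ball. *)
Definition sphere_measure (R : realType) (d : nat)
    (A : set (euclid R d.+1)) : \bar R :=
  ((d.+1%:R)%:E * lebesgue_euclid R d.+1
     [set x | A (radial_proj x) /\ (0 < enorm x <= 1)%R])%E.

Section sphere_measure.
Local Open Scope ereal_scope.
Variables (R : realType) (d : nat).

Let D : set (euclid R d.+1) := [set x | (0 < enorm x <= 1)%R].

Let mD : measurable D.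
Proof.
rewrite (_ : D = setT `&` @enorm R d.+1 @^-1` `]0%R, 1%R]).
  by apply: measurable_enorm => //; exact: measurable_itv.
by rewrite setTI; apply/seteqP; split => x /=; rewrite in_itv.
Qed.

Let mu : {measure set (euclid R d.+1) -> \bar R} :=
  mscale (NngNum (ler0n R d.+1))
    (measure_function_pushforward__canonical__measure_function_Measure
      (mrestr (lebesgue_euclid R d.+1) mD) (@measurable_radial_proj R d.+1)).

Let sphere_measureE : @sphere_measure R d = mu.
Proof. by []. Qed.

Let sphere_measure0 : @sphere_measure R d set0 = 0.
Proof. by rewrite sphere_measureE measure0. Qed.

Let sphere_measure_ge0 A : 0 <= @sphere_measure R d A.
Proof. by rewrite sphere_measureE measure_ge0. Qed.

Let sphere_measure_sigma_additive : semi_sigma_additive (@sphere_measure R d).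
Proof. by rewrite sphere_measureE; exact: measure_semi_sigma_additive. Qed.

HB.instance Definition _ := isMeasure.Build _ _ _ (@sphere_measure R d)
  sphere_measure0 sphere_measure_ge0 sphere_measure_sigma_additive.

End sphere_measure.

Definition sphere_area (R : realType) (d : nat) : R :=
  fine (@sphere_measure R d (@sphere R d)).

(* componentwise on real and imaginary parts *)
Definition sphere_integral (R : realType) (d : nat)
    (f : euclid R d.+1 -> R[i]) : R[i] :=
  (Rintegral (@sphere_measure R d) (@sphere R d) (fun x => complex.Re (f x)) +i*
   Rintegral (@sphere_measure R d) (@sphere R d) (fun x => complex.Im (f x))).

Definition cpoly_eval (R : realType) (n : nat) (p : mpoly.mpoly n R[i])
    (x : euclid R n) : R[i] :=
  mpoly.meval (fun i => (tnth x i : R)%:C) p.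

(* mpoly.msize is 1 + the total degree, and 0 for the zero polynomial. *)
Definition is_design (R : realType) (d t : nat) (X : {fset euclid R d.+1}) : Prop :=
  [/\ X != fset0,
      forall x, x \in X -> sphere x
    & forall p : mpoly.mpoly d.+1 R[i], (mpoly.msize p <= t.+1)%N ->
        (#|` X|%fset%:R)^-1 * \sum_(x <- X) cpoly_eval p x =
        ((sphere_area R d)%:C)^-1 * sphere_integral (cpoly_eval p)].

(* N_{S^d}(t); the infimum is a minimum as soon as a t-design exists
   (see min_designP), and +oo otherwise. *)
Definition min_design (R : realType) (d t : nat) : \bar R :=
  ereal_inf [set (#|` X|%fset%:R)%:E | X in [set X | @is_design R d t X]].

Lemma min_designP (R : realType) (d t : nat) (X : {fset euclid R d.+1}) :
  is_design t X ->
  exists2 Y : {fset euclid R d.+1}, is_design t Y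
    & min_design R d t = (#|` Y|%fset%:R)%:E.
Proof.
move=> dX.
pose P k := `[< exists2 Y : {fset euclid R d.+1}, is_design t Y & #|` Y|%fset = k >].
have exP : exists k, P k by exists #|` X|%fset; apply/asboolP; exists X.
case: (ex_minnP exP) => k /asboolP[Y dY <-] kmin.
exists Y => //; apply/eqP; rewrite eq_le; apply/andP; split.
  by apply: ereal_inf_lbound; exists Y.
apply: le_ereal_inf_tmp => _ [Z dZ <-].
by rewrite lee_fin ler_nat; apply: kmin; apply/asboolP; exists Z.
Qed.

(* Main.v *)
(* The Hopf map S^3 -> S^2 turns the mean over S^2 into the mean over S^3, and its
   fibres are the orbits of the circle group z |-> c z on S^3 in C^2.  Lift each
   point of a t-design on S^2 to S^3 and spread it over its fibre with the
   (s+1)-th roots of unity, where s is 2t or 2t + 1.  In the complex coordinates a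
   monomial of degree at most s either is multiplied by a character c^m of the circle
   with 0 < |m| <= s, and then it has mean zero both over S^3 and over every such
   orbit, or it is circle invariant, hence a polynomial of degree at most
   t in the Hopf coordinates |z|^2, |w|^2, z w^*.

   The equality of the two means is proved by infinitesimal rotations.  The surface
   measure is rotation invariant because a plane rotation is a product of three
   shears, so the mean annihilates x_i d_j - x_j d_i.  This kills the monomials that
   are not invariant under the coordinate rotations, and forces the others, on S^3
   as on S^2, to have the moments of the uniform distribution on [0, 1]. *)
Require Import Defs.
From mathcomp Require Import all_boot all_order all_algebra finmap.
From mathcomp Require Import -(notations) mpoly.
From mathcomp Require Import all_classical all_reals all_analysis.
From mathcomp Require Import measurable_realfun complex ring lra zify.
From mathcomp Require cyclic separable cyclotomic.

Set Implicit Arguments.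
Unset Strict Implicit.
Unset Printing Implicit Defensive.
Import Order.TTheory GRing.Theory Num.Theory.
Import numFieldNormedType.Exports.
Local Open Scope classical_set_scope.
Local Open Scope complex_scope.
Local Open Scope ring_scope.

Local Notation mpoly := mpoly.mpoly.
Local Notation mX i := (mpoly.mpolyX _ (mpoly.mnm1 i)).
Local Notation "c %:MP" := (mpoly.mpolyC _ c) (at level 2, format "c %:MP").

(** * Shear invariance of Lebesgue measure *)

Lemma lebesgue_measure_translation (R : realType) (c : R)
    (A : set (measurableTypeR R)) : measurable A ->
  lebesgue_measure ((fun x : measurableTypeR R => x + c : measurableTypeR R) @^-1` A)
  = lebesgue_measure A.
Proof.
move=> mA; pose f (x : measurableTypeR R) : measurableTypeR R := x + c.
have mf : measurable_fun setT f by exact: measurable_funD.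
change (pushforward lebesgue_measure f A = lebesgue_measure A).
apply/esym/lebesgue_measure_unique => // _ [[a b]] _ <-.
change (lebesgue_measure `]a, b]%classic = lebesgue_measure (f @^-1` `]a, b]%classic)).
rewrite (_ : f @^-1` _ = `](a - c), (b - c)]%classic).
  rewrite !lebesgue_measure_itv/= !lte_fin ltrD2r.
  by case: ifP => // _; rewrite -!EFinB; congr EFin; ring.
by apply/seteqP; split => x /=; rewrite !in_itv/= ltrBlDr lerBrDr.
Qed.

(** A shear along the axis [i] as soon as [g] does not read coordinate [i]. *)
Definition shift_at (R : realType) (n : nat) (i : 'I_n) (g : euclid R n -> R)
    (x : euclid R n) : euclid R n :=
  [tuple (tnth x k + (if k == i then g x else 0) : measurableTypeR R) | k < n].

Lemma measurable_shift_at (R : realType) (n : nat) (i : 'I_n)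
    (g : euclid R n -> R) :
  measurable_fun setT (g : euclid R n -> measurableTypeR R) ->
  measurable_fun [set: euclid R n] (shift_at i g).
Proof.
move=> mg; apply/measurable_fun_tnthP => k.
rewrite (_ : _ \o _ = fun x : euclid R n =>
   tnth x k + (if k == i then g x else 0)); last first.
  by apply/funext => x /=; rewrite tnth_mktuple.
by case: (k == i); apply: measurable_funD => //; exact: measurable_tnth.
Qed.

Lemma lebesgue_euclidSE (R : realType) (n : nat) (A : set (euclid R n.+1)) :
  lebesgue_euclid R n.+1 A =
  (lebesgue_measure \x lebesgue_euclid R n)%E (@cons_pair R n @^-1` A).
Proof. by []. Qed.

Lemma measurable_cons_pair_preimage (R : realType) (n : nat)
    (A : set (euclid R n.+1)) : measurable A ->
  measurable (@cons_pair R n @^-1` A).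
Proof.
by move=> mA; rewrite -[X in measurable X]setTI; exact: measurable_cons_pair.
Qed.

(** By Tonelli the first coordinate may also be integrated innermost, the order needed when it is
    the one being shifted. *)
Lemma lebesgue_euclidSE2 (R : realType) (n : nat) (A : set (euclid R n.+1)) :
  measurable A ->
  lebesgue_euclid R n.+1 A =
  (lebesgue_measure \x^ lebesgue_euclid R n)%E (@cons_pair R n @^-1` A).
Proof.
move=> mA; rewrite lebesgue_euclidSE.
have := indic_fubini_tonelli lebesgue_measure (lebesgue_euclid R n)
  (measurable_cons_pair_preimage mA).
rewrite indic_fubini_tonelli_FE ?indic_fubini_tonelli_GE//;
  exact: measurable_cons_pair_preimage.
Qed.

(** Fubini reduces the shear to sections. If the first coordinate is shifted, each section with the
    other coordinates fixed is translated by a constant; otherwise the first coordinate is frozen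
    and the induction hypothesis applies. *)
Lemma lebesgue_euclid_shift_at (R : realType) (n : nat) (i : 'I_n)
    (g : euclid R n -> R) (A : set (euclid R n)) :
  measurable_fun setT (g : euclid R n -> measurableTypeR R) ->
  (forall x y : euclid R n,
    (forall k, k != i -> tnth x k = tnth y k) -> g x = g y) ->
  measurable A ->
  lebesgue_euclid R n (shift_at i g @^-1` A) = lebesgue_euclid R n A.
Proof.
elim: n i g A => [|n IH] i g A mg gi mA; first by case: i {gi}.
have mSA : measurable (shift_at i g @^-1` A).
  by rewrite -[X in measurable X]setTI; exact: measurable_shift_at.
have [i0|[j ij]] : i = ord0 \/ exists j, i = lift ord0 j.
  by case: (unliftP ord0 i) => [j|] ->; [right; exists j|left].
- rewrite !lebesgue_euclidSE2//; apply: eq_integral => x _ /=.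
  set B := ysection _ _; set B' := ysection _ _.
  have mB' : measurable B'.
    by apply: measurable_ysection; exact: measurable_cons_pair_preimage.
  (* [g] ignores the first coordinate, so its value at first coordinate 0 is the translation for the
     whole section. *)
  rewrite -(lebesgue_measure_translation (g (cons_pair (0, x))) mB').
  congr (lebesgue_measure _); rewrite /B /B' /ysection/= i0.
  apply/seteqP; split => y /=; rewrite !inE/=;
  congr A; apply/eq_from_tnth => k; rewrite tnth_mktuple;
    (case: (unliftP ord0 k) => [l|] -> /=;
     [rewrite ?tnthS ?addr0//|
      rewrite ?tnth0; congr (_ + _); apply: gi => l;
      rewrite i0; case: (unliftP ord0 l) => [l'|] -> // _; by rewrite !tnthS]).
- rewrite !lebesgue_euclidSE; apply: eq_integral => y _ /=.
  set B := xsection _ _; set B' := xsection _ _.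
  have mB' : measurable B'.
    by apply: measurable_xsection; exact: measurable_cons_pair_preimage.
  rewrite -(IH j (fun x => g (cons_pair (y, x))) B')//; last 2 first.
  + have mc : measurable_fun setT (fun x : euclid R n => cons_pair (y, x)).
      apply: (measurableT_comp (@measurable_cons_pair R n)).
      exact: measurable_pair1.
    exact: (measurableT_comp mg mc).
  + move=> u v uv; apply: (gi (cons_pair (y, u)) (cons_pair (y, v))) => k; rewrite ij.
    case: (unliftP ord0 k) => [l|] -> kl; last by [].
    rewrite !tnthS; apply: uv.
    by apply: contra_neq kl => ->.
  congr (lebesgue_euclid R n _); rewrite /B /B' /xsection/= ij.
  apply/seteqP; split => x /=; rewrite !inE/=; congr A;
    apply/eq_from_tnth => k; rewrite tnth_mktuple;
    (case: (unliftP ord0 k) => [l|] -> /=;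
      [rewrite !tnthS tnth_mktuple// (inj_eq lift_inj)//|rewrite addr0//]).
Qed.

(** * Rotation invariance of the surface measure *)

(* Rotation by the angle 2 arctan u, in the rational parametrization. *)
Definition plane_rot (R : realType) (n : nat) (i j : 'I_n) (u : R) (x : euclid R n) :
    euclid R n :=
  [tuple (if k == i then
            (1 - u ^+ 2) / (1 + u ^+ 2) * tnth x i - 2 * u / (1 + u ^+ 2) * tnth x j
          else if k == j then
            2 * u / (1 + u ^+ 2) * tnth x i + (1 - u ^+ 2) / (1 + u ^+ 2) * tnth x j
          else tnth x k : measurableTypeR R) | k < n].

Section plane_rot.
Variables (R : realType) (n : nat) (i j : 'I_n) (u : R).
Hypothesis ij : i != j.

Let u2_neq0 : 1 + u ^+ 2 != 0.
Proof. by rewrite gt_eqF// ltr_pwDl// sqr_ge0. Qed.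

(** With theta the angle and u = tan(theta/2), the outer shears have slope -tan(theta/2) and the
    middle one sin(theta). The parametrization makes this an identity between rational functions of
    [u]. *)
Lemma plane_rot_shear : plane_rot i j u =
  shift_at i (fun x => - u * tnth x j) \o
  shift_at j (fun x => 2 * u / (1 + u ^+ 2) * tnth x i) \o
  shift_at i (fun x => - u * tnth x j).
Proof.
apply/funext => x; apply/eq_from_tnth => k /=.
rewrite !tnth_mktuple !eqxx (eq_sym j i) (negPf ij).
have [->|ki] := eqVneq k i; first by rewrite (negPf ij); field.
by have [->|kj] := eqVneq k j; [field|rewrite !addr0].
Qed.

Let measurable_shear (l : 'I_n) (a : R) :
  measurable_fun setT
    ((fun x : euclid R n => a * tnth x l) : euclid R n -> measurableTypeR R).
Proof. by apply: measurable_funM => //; exact: measurable_tnth. Qed.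

Lemma measurable_rot : measurable_fun [set: euclid R n] (plane_rot i j u).
Proof.
have m k l a := measurable_shift_at k (measurable_shear l a).
rewrite plane_rot_shear.
exact: (measurableT_comp (measurableT_comp (m i j _) (m j i _)) (m i j _)).
Qed.

Lemma lebesgue_euclid_rot (A : set (euclid R n)) : measurable A ->
  lebesgue_euclid R n (plane_rot i j u @^-1` A) = lebesgue_euclid R n A.
Proof.
move=> mA.
have shear (k l : 'I_n) (a : R) (B : set (euclid R n)) : k != l ->
    measurable B -> measurable (shift_at k (fun x => a * tnth x l) @^-1` B) /\
    lebesgue_euclid R n (shift_at k (fun x => a * tnth x l) @^-1` B) =
    lebesgue_euclid R n B.
  move=> kl mB; split.
    rewrite -[X in measurable X]setTI.
    exact: (measurable_shift_at k (measurable_shear l a) measurableT mB).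
  apply: (lebesgue_euclid_shift_at (measurable_shear l a)) => //.
  by move=> x y xy; rewrite xy// eq_sym.
rewrite plane_rot_shear !comp_preimage.
have [m1 e1] := shear i j (- u) A ij mA.
have ji : j != i by rewrite eq_sym.
have [m2 e2] := shear j i (2 * u / (1 + u ^+ 2)) _ ji m1.
have [_ e3] := shear i j (- u) _ ij m2.
by rewrite e3 e2 e1.
Qed.

Lemma enorm_rot (x : euclid R n) : enorm (plane_rot i j u x) = enorm x.
Proof.
have split_sum (y : euclid R n) : \sum_(k < n) tnth y k ^+ 2 =
    tnth y i ^+ 2 + tnth y j ^+ 2 +
    \sum_(k < n | (k != i) && (k != j)) tnth y k ^+ 2.
  rewrite (bigD1 i)//= -addrA; congr (_ + _).
  by rewrite (bigD1 j)//= eq_sym.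
rewrite /enorm !split_sum; congr (Num.sqrt (_ + _)).
  rewrite !tnth_mktuple !eqxx (eq_sym j i) (negPf ij).
  by field.
apply: eq_bigr => k /andP[ki kj].
by rewrite tnth_mktuple (negPf ki) (negPf kj).
Qed.

Lemma radial_proj_rot (x : euclid R n) :
  radial_proj (plane_rot i j u x) = plane_rot i j u (radial_proj x).
Proof.
apply/eq_from_tnth => k; rewrite !tnth_mktuple enorm_rot.
by case: (k == i); [ring|case: (k == j); [ring|]].
Qed.

End plane_rot.

Lemma measurable_sphere (R : realType) d : measurable (@sphere R d).
Proof.
rewrite (_ : @sphere R d = setT `&` @enorm R d.+1 @^-1` [set 1%R]).
  by apply: measurable_enorm => //; exact: measurable_set1.
by rewrite setTI.
Qed.

(** A rotation preserves the norm and commutes with radial projection, so the cone over the preimage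
    of [A] is the preimage of the cone over [A]. *)
Lemma sphere_measure_rot (R : realType) d (i j : 'I_d.+1) (u : R)
    (A : set (euclid R d.+1)) : i != j -> measurable A ->
  sphere_measure (plane_rot i j u @^-1` A) = sphere_measure A.
Proof.
move=> ij mA.
pose B := [set x : euclid R d.+1 | A (radial_proj x) /\ (0 < enorm x <= 1)].
have mB : measurable B.
  apply: measurableI.
    by rewrite -[X in measurable X]setTI; apply: measurable_radial_proj.
  rewrite [X in measurable X](_ : _ = setT `&` @enorm R d.+1 @^-1` `]0%R, 1%R]).
    by apply: measurable_enorm => //; exact: measurable_itv.
  by rewrite setTI; apply/seteqP; split => x /=; rewrite in_itv.
have -> : sphere_measure A = (d.+1%:R%:E * lebesgue_euclid R d.+1 B)%E by [].
rewrite -(lebesgue_euclid_rot u ij mB); congr (_ * lebesgue_euclid R _ _)%E.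
by apply/seteqP; split => x; rewrite /B /= enorm_rot// radial_proj_rot.
Qed.

(** * The area of the sphere is finite and positive *)

Lemma lebesgue_euclid_box_measurable (R : realType) n (a b : R) :
  measurable [set x : euclid R n | forall k, a < tnth x k <= b].
Proof.
rewrite (_ : [set _ | _] = \bigcap_(k in [set: 'I_n])
   ([set x : euclid R n | a < tnth x k <= b])); last first.
  by apply/seteqP; split => x /= H k => [_|]; exact: H.
apply: fin_bigcap_measurable => [|k _]; first exact: finite_finset.
rewrite [X in measurable X](_ : _ = setT `&` (fun x : euclid R n => tnth x k) @^-1` `]a, b]).
  by apply: measurable_tnth => //; exact: measurable_itv.
by rewrite setTI; apply/seteqP; split => x /=; rewrite in_itv.
Qed.

(** Cubes bound the area from both sides: one contains the unit ball, another fits inside it. *)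
Lemma lebesgue_euclid_box (R : realType) n (a b : R) : a <= b ->
  lebesgue_euclid R n [set x | forall k, a < tnth x k <= b] = ((b - a) ^+ n)%:E.
Proof.
move=> ab; elim: n => [|n IH].
  rewrite /= diracE expr0 mem_set//; first by move=> [].
have mb : measurable `]a, b]%classic by exact: measurable_itv.
have mab : lebesgue_measure (`]a, b]%classic : set (measurableTypeR R)) = (b - a)%:E.
  rewrite lebesgue_measure_itv/= lte_fin.
  by move: ab; rewrite le_eqVlt => /predU1P[->|->]; rewrite ?ltxx ?subrr -?EFinB.
rewrite lebesgue_euclidSE (_ : _ @^-1` _ =
  `]a, b]%classic `*` [set x : euclid R n | forall k, a < tnth x k <= b]).
  have mB := @lebesgue_euclid_box_measurable R n a b.
  transitivity (lebesgue_measure (`]a, b]%classic : set (measurableTypeR R)) *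
      lebesgue_euclid R n [set x | forall k, (a < tnth x k <= b)%R])%E.
    exact: product_measure1E.
  by rewrite IH mab exprS EFinM.
apply/seteqP; split => -[x y] /=.
  move=> H; split; first by have := H ord0; rewrite in_itv.
  by move=> k; have := H (lift ord0 k); rewrite tnthS.
rewrite in_itv/= => -[H1 H2] k.
by case: (unliftP ord0 k) => [l|] -> //; rewrite tnthS.
Qed.

Lemma sphere_measure_lty (R : realType) d (A : set (euclid R d.+1)) :
  measurable A -> (sphere_measure A < +oo)%E.
Proof.
move=> mA; apply: (@le_lt_trans _ _ (sphere_measure [set: euclid R d.+1])).
  by apply: le_measure => //; rewrite inE.
rewrite /sphere_measure lte_mul_pinfty// ?lee_fin//.
set B := [set x : euclid R d.+1 | _].
have mB : measurable B.
  rewrite /B [X in measurable X](_ : _ = setT `&` @enorm R d.+1 @^-1` `]0%R, 1%R]).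
    by apply: measurable_enorm => //; exact: measurable_itv.
  rewrite setTI; apply/seteqP; split => x /=; rewrite in_itv//=.
  by move=> [].
(* The cube is open on the left, so its lower bound must lie strictly below -1. *)
apply: (@le_lt_trans _ _ (lebesgue_euclid R d.+1
    [set x | forall k, -2 < tnth x k <= 2])).
  apply: le_measure; rewrite ?inE//; first exact: lebesgue_euclid_box_measurable.
  move=> x [_ /andP[_ x1]] k.
  have : `|tnth x k| <= 1.
    rewrite -sqrtr_sqr; apply: le_trans x1; apply: ler_wsqrtr.
    by rewrite (bigD1 k)//= lerDl sumr_ge0// => i _; exact: sqr_ge0.
  by rewrite ler_norml => /andP[? ?]; apply/andP; split; lra.
by rewrite lebesgue_euclid_box ?ltry//; lra.
Qed.

Lemma sphere_area_gt0 (R : realType) d : 0 < sphere_area R d.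
Proof.
rewrite /sphere_area fine_gt0// sphere_measure_lty ?andbT; last exact: measurable_sphere.
rewrite /sphere_measure mule_gt0 ?lte_fin//.
set B := [set x : euclid R d.+1 | _].
(* The cone over the whole sphere is the punctured unit ball, since [radial_proj x] has norm 1 when
   [x] is nonzero. *)
have BE : B = setT `&` @enorm R d.+1 @^-1` `]0%R, 1%R].
  rewrite setTI; apply/seteqP; split => x; rewrite /B/= in_itv/=; first by case.
  move=> /andP[x0 x1]; split; rewrite ?x0 ?x1//.
  rewrite /sphere/= -[RHS]sqrtr1; congr Num.sqrt.
  under eq_bigr do rewrite tnth_mktuple expr_div_n.
  rewrite -mulr_suml -[X in X / _](@sqr_sqrtr R); last first.
    by apply: sumr_ge0 => i _; exact: sqr_ge0.
  by rewrite divff// sqrf_eq0 gt_eqF.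
have mB : measurable B.
  by rewrite BE; apply: measurable_enorm => //; exact: measurable_itv.
have n0 : (0 : R) < d.+1%:R^-1 by rewrite invr_gt0.
(* In this cube each of the d + 1 squares is at most 1/(d + 1), so the norm is at most 1. *)
apply: (@lt_le_trans _ _ (lebesgue_euclid R d.+1
    [set x | forall k, 0 < tnth x k <= d.+1%:R^-1])).
  by rewrite lebesgue_euclid_box ?ltW// lte_fin exprn_gt0// subr0.
apply: le_measure; rewrite ?inE//; first exact: lebesgue_euclid_box_measurable.
move=> x /= xB; rewrite BE; split => //=; rewrite in_itv/=; apply/andP; split.
  rewrite sqrtr_gt0 (bigD1 ord0)//= ltr_pwDl//.
    by rewrite exprn_gt0//; have /andP[] := xB ord0.
  by apply: sumr_ge0 => i _; exact: sqr_ge0.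
rewrite -[leRHS]sqrtr1; apply: ler_wsqrtr.
apply: (@le_trans _ _ (\sum_(i < d.+1) d.+1%:R^-1)).
  apply: ler_sum => i _; have /andP[x0 x1] := xB i.
  have n1 : (d.+1%:R^-1 : R) <= 1 by rewrite invf_le1 ?ler1n.
  by rewrite -[leRHS]mulr1 expr2; apply: ler_pM (ltW x0) (ltW x0) x1 (le_trans x1 n1).
by rewrite sumr_const card_ord -[_ *+ _]mulr_natl divff.
Qed.

(** The surface measure is finite, so these functions are integrable. The bound is asked on the
    sphere only, because nonconstant polynomials are unbounded on the whole space. *)
Definition sphere_bounded (R : realType) d (f : euclid R d.+1 -> R) :=
  measurable_fun setT (f : euclid R d.+1 -> measurableTypeR R) /\
  exists C, forall x, sphere x -> `|f x| <= C.

(** * Integrals over the sphere under finite and infinitesimal rotations *)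

Section sphere_bounded.
Variables (R : realType) (d : nat).
Implicit Types f g : euclid R d.+1 -> R.

Lemma sphere_bounded_integrable f : sphere_bounded f ->
  (@sphere_measure R d).-integrable (@sphere R d) (EFin \o f).
Proof.
move=> [mf [C fC]]; apply: measurable_bounded_integrable.
- exact: measurable_sphere.
- by apply: sphere_measure_lty; exact: measurable_sphere.
- exact: measurable_funTS.
- exists C; split; first by rewrite num_real.
  by move=> M CM x xS /=; apply: le_trans (fC x xS) _; exact: ltW.
Qed.

Lemma sphere_boundedZ (a : R) f : sphere_bounded f ->
  sphere_bounded (fun x => a * f x).
Proof.
move=> [mf [C fC]]; split; first exact: measurable_funM.
exists (`|a| * C) => x xS.
by rewrite normrM ler_wpM2l// fC.
Qed.

Lemma sphere_boundedD f g : sphere_bounded f -> sphere_bounded g ->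
  sphere_bounded (fun x => f x + g x).
Proof.
move=> [mf [C fC]] [mg [C' gC]]; split; first exact: measurable_funD.
exists (C + C') => x xS.
by rewrite (le_trans (ler_normD _ _))// lerD ?fC ?gC.
Qed.

Lemma sphere_boundedM f g : sphere_bounded f -> sphere_bounded g ->
  sphere_bounded (fun x => f x * g x).
Proof.
move=> [mf [C fC]] [mg [C' gC]]; split; first exact: measurable_funM.
exists (C * C') => x xS.
by rewrite normrM ler_pM ?fC ?gC.
Qed.

Lemma sphere_boundedB f g : sphere_bounded f -> sphere_bounded g ->
  sphere_bounded (fun x => f x - g x).
Proof.
move=> bf bg; rewrite (_ : (fun _ => _) = (fun x => f x + -1 * g x)).
  exact/sphere_boundedD/sphere_boundedZ.
by apply/funext => x; rewrite mulN1r.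
Qed.

Lemma sphere_bounded_rot i j (u : R) f : i != j -> sphere_bounded f ->
  sphere_bounded (f \o plane_rot i j u).
Proof.
move=> ij [mf [C fC]]; split.
  exact: (measurableT_comp mf (measurable_rot u ij)).
exists C => x xS; apply: fC.
by rewrite /sphere/= enorm_rot.
Qed.

(** A change of variables: the rotation pushes the surface measure forward to itself, and the sphere
    is its own preimage. *)
Lemma Rintegral_sphere_rot i j (u : R) f : i != j -> sphere_bounded f ->
  Rintegral (@sphere_measure R d) (@sphere R d) (f \o plane_rot i j u) =
  Rintegral (@sphere_measure R d) (@sphere R d) f.
Proof.
move=> ij bf; congr fine.
have SE : plane_rot i j u @^-1` @sphere R d = @sphere R d.
  by apply/seteqP; split => x; rewrite /sphere/= enorm_rot.
have mE : measurable_fun setT (EFin \o f) by apply/measurable_EFinP; case: bf.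
have intf : (@sphere_measure R d).-integrable (plane_rot i j u @^-1` @sphere R d)
    ((EFin \o f) \o plane_rot i j u).
  by rewrite SE; exact: (sphere_bounded_integrable (sphere_bounded_rot u ij bf)).
rewrite -[in LHS]SE.
rewrite -[LHS](integral_pushforward (measurable_rot u ij) mE intf); last first.
  exact: measurable_sphere.
apply: eq_measure_integral => [|mr A mA _]; first exact: (measurable_rot u ij).
exact: (sphere_measure_rot u ij mA).
Qed.

(** [g] is the derivative of [f] along the rotation at u = 0. The integral of [f] does not change
    under rotation, so integrating the expansion leaves u |I| <= C u^2 m, where m is the area;
    divide by u and let u tend to 0. The uniform quadratic remainder replaces differentiation under
    the integral. *)
Lemma Rintegral_rot_derivative i j f g (C : R) : i != j ->
  sphere_bounded f -> sphere_bounded g ->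
  (forall u x, 0 <= u <= 1 -> sphere x ->
    `|f (plane_rot i j u x) - f x - u * g x| <= C * u ^+ 2) ->
  Rintegral (@sphere_measure R d) (@sphere R d) g = 0.
Proof.
move=> ij bf bg H; set I := Rintegral _ _ _.
pose m := fine (sphere_measure (@sphere R d)).
have Im u : 0 < u <= 1 -> `|I| <= C * u * m.
  move=> /andP[u0 u1]; rewrite -(ler_pM2l u0).
  have bfr := sphere_bounded_rot u ij bf.
  have b1 := sphere_boundedB bfr bf.
  have b2 := sphere_boundedZ u bg.
  have b3 := sphere_boundedB b1 b2.
  have mS := @measurable_sphere R d.
  have -> : u * `|I| = `|Rintegral (@sphere_measure R d) (@sphere R d)
     (fun x => f (plane_rot i j u x) - f x - u * g x)|.
    rewrite (RintegralB (f1 := fun x => f (plane_rot i j u x) - f x)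
       (f2 := fun x => u * g x))//; last 2 first.
    - exact: sphere_bounded_integrable b1.
    - exact: sphere_bounded_integrable b2.
    rewrite (RintegralB (f1 := f \o plane_rot i j u))//; last 2 first.
    - exact: sphere_bounded_integrable bfr.
    - exact: sphere_bounded_integrable bf.
    rewrite Rintegral_sphere_rot// subrr sub0r normrN RintegralZl//.
      by rewrite normrM (gtr0_norm u0).
    exact: sphere_bounded_integrable bg.
  apply: le_trans.
    apply: le_normr_Rintegral => //; exact: sphere_bounded_integrable b3.
  rewrite (_ : u * (C * u * m) = Rintegral (@sphere_measure R d) (@sphere R d)
     (cst (C * u ^+ 2))); last by rewrite Rintegral_cst// -/m; ring.
  apply: le_Rintegral => //.
  - apply: (sphere_bounded_integrable (f := fun x => `|_|)); split.
      by apply: measurableT_comp => //; case: b3.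
    by case: b3 => _ [K HK]; exists K => x xS; rewrite normr_id HK.
  - apply: (sphere_bounded_integrable (f := cst _)); split => //.
    by exists `|C * u ^+ 2|.
  - by move=> x xS; apply: H; rewrite ?(ltW u0).
apply/eqP; rewrite -normr_eq0; apply/negPn/negP => I0.
have Ip : 0 < `|I| by rewrite lt_def I0 normr_ge0.
have m0 : 0 <= m by exact: fine_ge0.
(* This [K] dominates both [C * m] and the modulus of [I], so u = |I|/(2K) lies in (0, 1] and turns
   the bound above into |I| <= |I|/2. *)
pose K := `|C| * m + `|I|.
have K0 : 0 < K by rewrite ltr_wpDl// mulr_ge0.
have u0 : 0 < `|I| / (2 * K) <= 1.
  rewrite divr_gt0 ?mulr_gt0//= ler_pdivrMr ?mulr_gt0// mul1r.
  rewrite /K; have : 0 <= `|C| * m by rewrite mulr_ge0.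
  by lra.
have := Im _ u0; apply/negP; rewrite -ltNge.
apply: (@le_lt_trans _ _ (K * (`|I| / (2 * K)))).
  rewrite mulrAC ler_wpM2r// ?divr_ge0 ?mulr_ge0 ?(ltW K0)//.
  by rewrite /K ler_wpDr// ler_wpM2r// ler_norm.
have -> : K * (`|I| / (2 * K)) = `|I| / 2 by field; rewrite gt_eqF.
by lra.
Qed.

End sphere_bounded.

(** * Polynomials on the sphere *)

(** Suited to sum and product rules: only constants and variables remain to be checked. *)
Lemma mpoly_ring_ind (n : nat) (S : nzRingType) (P : mpoly n S -> Prop) :
  (forall c, P (c%:MP)) -> (forall i, P (mX i)) ->
  (forall p q, P p -> P q -> P (p + q)) ->
  (forall p q, P p -> P q -> P (p * q)) -> forall p, P p.
Proof.
move=> PC PX PD PM.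
have P1 : P 1 by rewrite -mpoly.mpolyC1.
have PXn i k : P (mX i ^+ k).
  by elim: k => [|k IH]; [rewrite expr0|rewrite exprS; exact: (PM)].
elim/mpoly.mpolyind => [|c m p _ _ Pp]; first by rewrite -mpoly.mpolyC0.
apply: (PD) => //; rewrite -mpoly.mul_mpolyC; apply: (PM) => //.
rewrite mpoly.mpolyXE_id; elim/big_rec: _ => // i q _ Pq.
exact: (PM).
Qed.

Lemma normr_increment_add (K : numDomainType) (w a b f g f' g' : K) :
  `|a + b - (f + g) - w * (f' + g')| <= `|a - f - w * f'| + `|b - g - w * g'|.
Proof.
have -> : a + b - (f + g) - w * (f' + g') = (a - f - w * f') + (b - g - w * g').
  by ring.
exact: ler_normD.
Qed.

(** The Leibniz rule with its remainder: [a], [b] are the new values, [f], [g] the old ones, [w] the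
    time step. The bound collects the errors of the two factors and the second-order cross term. *)
Lemma normr_increment_mul (K : numDomainType) (w a b f g f' g' : K) :
  `|a * b - f * g - w * (f' * g + f * g')| <=
  `|a - f - w * f'| * `|b| + (`|f| + `|w| * `|f'|) * `|b - g - w * g'| +
  `|w| ^+ 2 * (`|f'| * `|g'|).
Proof.
have -> : a * b - f * g - w * (f' * g + f * g') =
    (a - f - w * f') * b + (f + w * f') * (b - g - w * g') + w ^+ 2 * (f' * g').
  by ring.
apply: (le_trans (ler_normD _ _)); apply: lerD; last by rewrite normrM normrX (normrM f').
apply: (le_trans (ler_normD _ _)); apply: lerD; first by rewrite normrM.
by rewrite normrM ler_wpM2r// (le_trans (ler_normD _ _))// normrM.
Qed.

Section eval.
Variables (R : realType) (d : nat).
Implicit Types p q : mpoly d.+1 R[i].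

Lemma cpoly_evalC c (x : euclid R d.+1) : cpoly_eval (c%:MP) x = c.
Proof. exact: mpoly.mevalC. Qed.

Lemma cpoly_evalX i (x : euclid R d.+1) : cpoly_eval (mX i) x = (tnth x i : R)%:C.
Proof. exact: mpoly.mevalXU. Qed.

Lemma cpoly_evalD p q x : cpoly_eval (p + q) x = cpoly_eval p x + cpoly_eval q x.
Proof. exact: mpoly.mevalD. Qed.

Lemma cpoly_evalB p q x : cpoly_eval (p - q) x = cpoly_eval p x - cpoly_eval q x.
Proof. exact: mpoly.mevalB. Qed.

Lemma cpoly_evalM p q x : cpoly_eval (p * q) x = cpoly_eval p x * cpoly_eval q x.
Proof. exact: mpoly.mevalM. Qed.

Lemma cpoly_evalZ c p x : cpoly_eval (c *: p) x = c * cpoly_eval p x.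
Proof. exact: mpoly.mevalZ. Qed.

Lemma ReM (a b : R[i]) : complex.Re (a * b) =
  complex.Re a * complex.Re b - complex.Im a * complex.Im b.
Proof. by case: a b => [? ?] [? ?]. Qed.

Lemma ImM (a b : R[i]) : complex.Im (a * b) =
  complex.Re a * complex.Im b + complex.Im a * complex.Re b.
Proof. by case: a b => [? ?] [? ?]. Qed.

Lemma ReD (a b : R[i]) : complex.Re (a + b) = complex.Re a + complex.Re b.
Proof. by case: a b => [? ?] [? ?]. Qed.

Lemma ImD (a b : R[i]) : complex.Im (a + b) = complex.Im a + complex.Im b.
Proof. by case: a b => [? ?] [? ?]. Qed.

Lemma normc_real (r : R) : `|r%:C| = `|r|%:C.
Proof. by rewrite normc_def/= expr0n/= addr0 sqrtr_sqr. Qed.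

Lemma le_Re_normc (z : R[i]) (C : R) : `|z| <= C%:C -> `|complex.Re z| <= C.
Proof.
rewrite normc_def lecR; apply: le_trans; rewrite -sqrtr_sqr; apply: ler_wsqrtr.
by rewrite lerDl sqr_ge0.
Qed.

Lemma le_Im_normc (z : R[i]) (C : R) : `|z| <= C%:C -> `|complex.Im z| <= C.
Proof.
rewrite normc_def lecR; apply: le_trans; rewrite -sqrtr_sqr; apply: ler_wsqrtr.
by rewrite lerDr sqr_ge0.
Qed.

Lemma sphere_tnth_le1 (x : euclid R d.+1) k : sphere x -> `|tnth x k : R| <= 1.
Proof.
move=> <-; rewrite -sqrtr_sqr; apply: ler_wsqrtr.
by rewrite (bigD1 k)//= lerDl sumr_ge0// => i _; exact: sqr_ge0.
Qed.

Lemma sphere_bounded_eval p :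
  sphere_bounded (fun x => complex.Re (cpoly_eval p x)) /\
  sphere_bounded (fun x => complex.Im (cpoly_eval p x)).
Proof.
have bc c : sphere_bounded (cst c : euclid R d.+1 -> R).
  by split; [exact: measurable_cst|exists `|c|].
elim/mpoly_ring_ind: p => [c|i|p q [rp ip] [rq iq]|p q [rp ip] [rq iq]].
- by split; under eq_fun do rewrite cpoly_evalC; exact: bc.
- split; under eq_fun do rewrite cpoly_evalX/=; last exact: bc.
  split; first exact: measurable_tnth.
  by exists 1 => x xS; exact: sphere_tnth_le1.
- by split; under eq_fun do rewrite cpoly_evalD ?ReD ?ImD; exact: sphere_boundedD.
- split; under eq_fun do rewrite cpoly_evalM ?ReM ?ImM.
    by apply: sphere_boundedB; exact: sphere_boundedM.
  by apply: sphere_boundedD; exact: sphere_boundedM.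
Qed.

Lemma cpoly_eval_bounded p : exists2 C : R, 0 <= C &
  forall x, sphere x -> `|cpoly_eval p x| <= C%:C.
Proof.
have [[_ [C HC]] [_ [C' HC']]] := sphere_bounded_eval p.
exists (`|C| + `|C'|) => [|x xS]; first by rewrite addr_ge0.
rewrite [cpoly_eval p x]complexE (le_trans (ler_normD _ _))// normrM.
have -> : `|'i%C : R[i]| = 1 by rewrite normc_def/= expr0n expr1n/= add0r sqrtr1.
rewrite mul1r !normc_real -rmorphD lecR lerD//.
  by rewrite (le_trans (HC _ xS))// ler_norm.
by rewrite (le_trans (HC' _ xS))// ler_norm.
Qed.

(* Half the velocity of [plane_rot i j u] at u = 0. *)
Definition rot_deriv (i j : 'I_d.+1) p : mpoly d.+1 R[i] :=
  mX i * mpoly.mderiv j p - mX j * mpoly.mderiv i p.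

Lemma rot_derivC i j c : rot_deriv i j (c%:MP) = 0.
Proof. by rewrite /rot_deriv !mpoly.mderivC !mulr0 subrr. Qed.

Lemma rot_derivX i j k : rot_deriv i j (mX k) =
  (if k == j then mX i else 0) - (if k == i then mX j else 0).
Proof.
have subUU l : mpoly.mnm_sub (mpoly.mnm1 l) (mpoly.mnm1 l) = mpoly.mnm0 :> mpoly.multinom d.+1.
  by apply/mpoly.mnmP => m; rewrite mpoly.mnmBE mpoly.mnm0E subnn.
rewrite /rot_deriv !mpoly.mderivX !mpoly.mnm1E; congr (_ - _).
  have [->|_] := eqVneq k j; last by rewrite scale0r mulr0.
  by rewrite subUU mpoly.mpolyX0 scale1r mulr1.
have [->|_] := eqVneq k i; last by rewrite scale0r mulr0.
by rewrite subUU mpoly.mpolyX0 scale1r mulr1.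
Qed.

Lemma rot_derivD i j p q :
  rot_deriv i j (p + q) = rot_deriv i j p + rot_deriv i j q.
Proof. by rewrite /rot_deriv !mpoly.mderivD; ring. Qed.

Lemma rot_derivM i j p q :
  rot_deriv i j (p * q) = rot_deriv i j p * q + p * rot_deriv i j q.
Proof. by rewrite /rot_deriv !mpoly.mderivM; ring. Qed.

(** A first-order Taylor formula along the rotation, uniform over the sphere; the time is 2u because
    the angle is 2 arctan u. Such estimates are stable under sums and products, whence the induction
    over ring generators. *)
Lemma cpoly_eval_rot i j p : i != j -> exists2 C : R, 0 <= C &
  forall u x, 0 <= u <= 1 -> sphere x ->
  `|cpoly_eval p (plane_rot i j u x) - cpoly_eval p x -
    (2 * u)%:C * cpoly_eval (rot_deriv i j p) x| <= (C * u ^+ 2)%:C.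
Proof.
move=> ij; elim/mpoly_ring_ind: p => [c|k|p q [C C0 HC] [C' C'0 HC']|].
- exists 0 => // u x _ _.
  by rewrite rot_derivC -mpoly.mpolyC0 !cpoly_evalC mulr0 !subr0 subrr normr0 mul0r.
- exists 4 => // u x /andP[u0 u1] xS.
  have xi := sphere_tnth_le1 i xS; have xj := sphere_tnth_le1 j xS.
  have u2 : 0 < 1 + u ^+ 2 by rewrite ltr_pwDl// sqr_ge0.
  (* A rotated coordinate differs from its linear approximation by [2 * a * y + 2 * a * u * z] up to
     sign, with y and z coordinates up to sign. As a <= u^2 and u <= 1, the constant 4 suffices. *)
  have [a aE] : exists a, a = u ^+ 2 / (1 + u ^+ 2) by eexists.
  have a0 : 0 <= a by rewrite aE divr_ge0 ?sqr_ge0// ltW.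
  have au : a <= u ^+ 2.
    by rewrite aE ler_pdivrMr// ler_peMr ?sqr_ge0// lerDl sqr_ge0.
  have key (y z : R) : `|y| <= 1 -> `|z| <= 1 ->
      `|- (2 * a * y) - 2 * a * u * z| <= 4 * u ^+ 2.
    move=> y1 z1; rewrite -opprD normrN; apply: le_trans (ler_normD _ _) _.
    have -> : `|2 * a * y| = 2 * (a * `|y|).
      by rewrite !normrM (ger0_norm a0) ger0_norm// mulrA.
    have -> : `|2 * a * u * z| = 2 * (a * (u * `|z|)).
      by rewrite !normrM (ger0_norm a0) (ger0_norm u0) ger0_norm// !mulrA.
    have : a * `|y| <= a by rewrite ler_piMr.
    have : a * (u * `|z|) <= a by rewrite ler_piMr// mulr_ile1.
    lra.
  rewrite rot_derivX cpoly_evalX.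
  rewrite cpoly_evalX cpoly_evalB !(fun_if (fun p => cpoly_eval p x)) !cpoly_evalX.
  rewrite -!mpoly.mpolyC0 !cpoly_evalC tnth_mktuple.
  have [->|ki] := eqVneq k i.
    rewrite (negPf ij) sub0r mulrN opprK -!(rmorphM, rmorphB, rmorphD)/=.
    rewrite normc_real lecR; have xj' : `|- (tnth x j : R)| <= 1 by rewrite normrN.
    apply: le_trans (key _ _ xi xj').
    rewrite le_eqVlt; apply/orP; left; apply/eqP; congr (`|_|).
    by rewrite aE; field; rewrite gt_eqF.
  have [->|kj] := eqVneq k j.
    rewrite subr0 -!(rmorphM, rmorphB, rmorphD)/=.
    rewrite normc_real lecR; apply: le_trans (key _ _ xj xi).
    rewrite le_eqVlt; apply/orP; left; apply/eqP.
    congr (`|_|).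
    by rewrite aE; field; rewrite gt_eqF.
  by rewrite !subrr mulr0 subr0 normr0 lecR mulr_ge0// sqr_ge0.
- exists (C + C') => [|u x u01 xS]; first exact: addr_ge0.
  rewrite rot_derivD (cpoly_evalD (rot_deriv i j p)) !(cpoly_evalD p q).
  have -> : ((C + C') * u ^+ 2)%:C = (C * u ^+ 2)%:C + (C' * u ^+ 2)%:C.
    by rewrite -rmorphD mulrDl.
  apply: le_trans _ (lerD (HC u x u01 xS) (HC' u x u01 xS)).
  exact: normr_increment_add.
- move=> p q [C C0 HC] [C' C'0 HC'].
  have [A A0 HA] := cpoly_eval_bounded p.
  have [B B0 HB] := cpoly_eval_bounded q.
  have [A' A'0 HA'] := cpoly_eval_bounded (rot_deriv i j p).
  have [B' B'0 HB'] := cpoly_eval_bounded (rot_deriv i j q).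
  (* The three terms of [normr_increment_mul] with w = 2u: |w| <= 2 in the middle one, |w|^2 = 4u^2
     in the last. *)
  exists (C * B + (A + 2 * A') * C' + 4 * (A' * B')) => [|u x u01 xS].
    by rewrite !addr_ge0 ?mulr_ge0// addr_ge0// mulr_ge0.
  have x'S : sphere (plane_rot i j u x) by rewrite /sphere/= enorm_rot.
  have /andP[u0 u1] := u01.
  rewrite rot_derivM (cpoly_evalD (rot_deriv i j p * q)) !(cpoly_evalM p q).
  rewrite (cpoly_evalM p) (cpoly_evalM _ q).
  apply: (le_trans (normr_increment_mul _ _ _ _ _ _ _)).
  have nu : `|(2 * u)%:C| <= (2 : R)%:C.
    by rewrite normc_real lecR ger0_norm ?mulr_ge0//; lra.
  have -> : ((C * B + (A + 2 * A') * C' + 4 * (A' * B')) * u ^+ 2)%:C =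
    (C * u ^+ 2)%:C * B%:C + (A%:C + 2%:C * A'%:C) * (C' * u ^+ 2)%:C +
    2%:C ^+ 2 * (A'%:C * B'%:C) * (u%:C ^+ 2).
    by rewrite -!(rmorphM, rmorphXn, rmorphD)/=; congr (_%:C); ring.
  apply: lerD; first apply: lerD.
  - exact: (ler_pM _ _ (HC u x u01 xS) (HB _ x'S)).
  - apply: (ler_pM _ _ _ (HC' u x u01 xS)) => //.
    apply: (lerD (HA _ xS)); exact: (ler_pM _ _ nu (HA' _ xS)).
  - rewrite normc_real (ger0_norm (mulr_ge0 _ u0))//.
    have -> : ((2 * u)%:C : R[i]) = 2%:C * u%:C by rewrite -rmorphM.
    rewrite exprMn mulrAC.
    apply: ler_wpM2r; first by rewrite exprn_ge0// lecR.
    apply: ler_wpM2l; first by rewrite exprn_ge0// lecR.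
    exact: (ler_pM _ _ (HA' _ xS) (HB' _ xS)).
Qed.

End eval.

(** * Mean values of polynomials over the sphere *)

Definition sphere_mean (R : realType) d (p : mpoly d.+1 R[i]) : R[i] :=
  ((sphere_area R d)%:C)^-1 * sphere_integral (cpoly_eval p).

Section sphere_mean.
Variables (R : realType) (d : nat).
Implicit Types p q : mpoly d.+1 R[i].

Lemma eq_sphere_mean p q :
  (forall x, sphere x -> cpoly_eval p x = cpoly_eval q x) ->
  sphere_mean p = sphere_mean q.
Proof.
move=> pq; congr (_ * _); rewrite /sphere_integral.
by congr (_ +i* _); apply: eq_Rintegral => x /[1!inE] xS; rewrite pq.
Qed.

Lemma sphere_meanD p q : sphere_mean (p + q) = sphere_mean p + sphere_mean q.
Proof.
have mS := @measurable_sphere R d.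
have [bp1 bp2] := sphere_bounded_eval p; have [bq1 bq2] := sphere_bounded_eval q.
rewrite /sphere_mean -mulrDr; congr (_ * _); rewrite /sphere_integral.
transitivity (
  (Rintegral (@sphere_measure R d) (@sphere R d) (fun x => complex.Re (cpoly_eval p x)) +
   Rintegral (@sphere_measure R d) (@sphere R d) (fun x => complex.Re (cpoly_eval q x))) +i*
  (Rintegral (@sphere_measure R d) (@sphere R d) (fun x => complex.Im (cpoly_eval p x)) +
   Rintegral (@sphere_measure R d) (@sphere R d) (fun x => complex.Im (cpoly_eval q x))));
  last by [].
rewrite -!RintegralD//; try exact: sphere_bounded_integrable.
by congr (_ +i* _); apply: eq_Rintegral => x _; rewrite cpoly_evalD ?ReD ?ImD.
Qed.

Lemma sphere_meanZ c p : sphere_mean (c *: p) = c * sphere_mean p.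
Proof.
have mS := @measurable_sphere R d.
have [bp1 bp2] := sphere_bounded_eval p.
rewrite /sphere_mean mulrCA; congr (_ * _); rewrite /sphere_integral.
case: c => a b.
have E1 := sphere_bounded_integrable (sphere_boundedZ a bp1).
have E2 := sphere_bounded_integrable (sphere_boundedZ b bp2).
have E3 := sphere_bounded_integrable (sphere_boundedZ b bp1).
have E4 := sphere_bounded_integrable (sphere_boundedZ a bp2).
rewrite [RHS]/GRing.mul/= -!RintegralZl//; try exact: sphere_bounded_integrable.
rewrite -RintegralB// -RintegralD//.
by congr (_ +i* _); apply: eq_Rintegral => x _; rewrite cpoly_evalZ; case: (cpoly_eval p x).
Qed.

Lemma sphere_mean_sum (I : Type) (r : seq I) (F : I -> mpoly d.+1 R[i]) :
  sphere_mean (\sum_(i <- r) F i) = \sum_(i <- r) sphere_mean (F i).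
Proof.
elim: r => [|i r IH]; last by rewrite !big_cons sphere_meanD IH.
by rewrite !big_nil -(scale0r 0) sphere_meanZ mul0r.
Qed.

Lemma sphere_mean1 : sphere_mean (1 : mpoly d.+1 R[i]) = 1.
Proof.
have a0 : ((sphere_area R d)%:C : R[i]) != 0.
  by rewrite (inj_eq (@complexI R)) gt_eqF// sphere_area_gt0.
have mS := @measurable_sphere R d.
rewrite /sphere_mean -[RHS](mulVf a0); congr (_ * _).
rewrite /sphere_integral -mpoly.mpolyC1.
under eq_Rintegral do rewrite cpoly_evalC/=.
under [X in _ +i* X]eq_Rintegral do rewrite cpoly_evalC/=.
by rewrite !Rintegral_cst// mul1r mul0r.
Qed.

(** Rotation invariance in infinitesimal form. Real and imaginary parts are treated separately, and
    first for twice [rot_deriv], the actual velocity at u = 0. *)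
Lemma sphere_mean_rot_deriv i j p : i != j -> sphere_mean (rot_deriv i j p) = 0.
Proof.
move=> ij; have [C C0 H] := cpoly_eval_rot p ij.
have [bp1 bp2] := sphere_bounded_eval p.
have [bq1 bq2] := sphere_bounded_eval (2%:C *: rot_deriv i j p).
suff : sphere_mean (2%:C *: rot_deriv i j p) = 0.
  move/eqP; rewrite sphere_meanZ mulf_eq0 => /orP[|/eqP//].
  by rewrite (inj_eq (@complexI R)) pnatr_eq0.
rewrite /sphere_mean /sphere_integral.
rewrite (Rintegral_rot_derivative ij bp1 bq1 (C := C)); last first.
  move=> u x u01 xS; apply: le_trans (le_Re_normc (H u x u01 xS)).
  rewrite le_eqVlt; apply/orP; left; apply/eqP; congr (`|_|).
  by rewrite cpoly_evalZ; do ![case: (cpoly_eval _ _) => ? ?]; rewrite /=; ring.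
rewrite (Rintegral_rot_derivative ij bp2 bq2 (C := C)) ?mulr0//.
move=> u x u01 xS; apply: le_trans (le_Im_normc (H u x u01 xS)).
rewrite le_eqVlt; apply/orP; left; apply/eqP; congr (`|_|).
by rewrite cpoly_evalZ; do ![case: (cpoly_eval _ _) => ? ?]; rewrite /=; ring.
Qed.

(** The squares add up to 1 on the sphere; this relates moments of different degrees. *)
Lemma sphere_mean_radial p : sphere_mean ((\sum_i mX i ^+ 2) * p) = sphere_mean p.
Proof.
apply: eq_sphere_mean => x xS; rewrite cpoly_evalM.
suff -> : cpoly_eval (\sum_i mX i ^+ 2) x = 1 by rewrite mul1r.
have -> : cpoly_eval (\sum_i mX i ^+ 2) x = (\sum_i (tnth x i : R) ^+ 2)%:C.
  rewrite /cpoly_eval (rmorph_sum (mpoly.meval _)) rmorph_sum.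
  by apply: eq_bigr => i _; rewrite rmorphXn/= mpoly.mevalXU rmorphXn.
rewrite -[X in X%:C]sqr_sqrtr ?sumr_ge0// => [|i _]; last exact: sqr_ge0.
by have -> : Num.sqrt (\sum_i (tnth x i : R) ^+ 2) = 1 by []; rewrite expr1n.
Qed.

End sphere_mean.

(** * Weights under coordinate rotations *)

Section rot_eigen.
Variables (R : realType) (d : nat).
Implicit Types p q : mpoly d.+1 R[i].

(** Weight spaces of the rotation in the plane (i, j). As [rot_deriv] is a derivation, weights add
    under products; weight 0 is invariance. *)
Definition rot_eigen (i j : 'I_d.+1) (c : R[i]) p := rot_deriv i j p = c *: p.

Lemma rot_eigenM i j c c' p q : rot_eigen i j c p -> rot_eigen i j c' q ->
  rot_eigen i j (c + c') (p * q).
Proof.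
by rewrite /rot_eigen rot_derivM => -> ->; rewrite scalerDl scalerAl scalerAr.
Qed.

Lemma rot_eigenC i j c : rot_eigen i j 0 (c%:MP).
Proof. by rewrite /rot_eigen rot_derivC scale0r. Qed.

Lemma rot_eigen1 i j : rot_eigen i j 0 1.
Proof. by rewrite -mpoly.mpolyC1; exact: rot_eigenC. Qed.

Lemma rot_eigenXn i j c p n : rot_eigen i j c p ->
  rot_eigen i j (c * n%:R) (p ^+ n).
Proof.
move=> pc; elim: n => [|n IH]; first by rewrite mulr0 expr0; exact: rot_eigen1.
by rewrite exprS -natr1 mulrDr mulr1 addrC; exact: rot_eigenM.
Qed.

(** The mean of [c *: p] vanishes, being that of a rotational derivative, and [c] is invertible. *)
Lemma sphere_mean_rot_eigen i j c p : i != j -> c != 0 -> rot_eigen i j c p ->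
  sphere_mean p = 0.
Proof.
move=> ij c0 pc; have := sphere_mean_rot_deriv p ij; rewrite pc sphere_meanZ.
by move/eqP; rewrite mulf_eq0 (negPf c0) => /eqP.
Qed.

Lemma sphere_meanB p q : sphere_mean (p - q) = sphere_mean p - sphere_mean q.
Proof. by rewrite sphere_meanD -scaleN1r sphere_meanZ mulN1r. Qed.

Lemma rot_derivXn i j p n :
  rot_deriv i j (p ^+ n) = n%:R * p ^+ n.-1 * rot_deriv i j p.
Proof.
elim: n => [|n IH]; first by rewrite expr0 -mpoly.mpolyC1 rot_derivC !mul0r.
rewrite exprS rot_derivM IH -natr1; case: n {IH} => [|n] /=; first by ring.
by rewrite exprS; ring.
Qed.

(** For invariant [p] the derivative of [mX i * mX j * p] is [(mX i ^+ 2 - mX j ^+ 2) * p]. *)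
Lemma sphere_mean_swap i j p : i != j -> rot_eigen i j 0 p ->
  sphere_mean (mX i ^+ 2 * p) = sphere_mean (mX j ^+ 2 * p).
Proof.
move=> ij p0; apply/eqP; rewrite -subr_eq0 -sphere_meanB; apply/eqP.
rewrite -[RHS](sphere_mean_rot_deriv (mX i * mX j * p) ij); congr sphere_mean.
rewrite !rot_derivM p0 scale0r !rot_derivX !eqxx (eq_sym j) (negPf ij).
by ring.
Qed.

Lemma sphere_mean_square_snd i j p : i != j -> rot_eigen i j 0 p ->
  2 * sphere_mean (mX j ^+ 2 * p) = sphere_mean ((mX i ^+ 2 + mX j ^+ 2) * p).
Proof.
move=> ij p0; rewrite [in RHS]mulrDl sphere_meanD (sphere_mean_swap ij p0).
by rewrite mulr_natl mulr2n.
Qed.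

Lemma sphere_mean_square_fst i j p : i != j -> rot_eigen i j 0 p ->
  2 * sphere_mean (mX i ^+ 2 * p) = sphere_mean ((mX i ^+ 2 + mX j ^+ 2) * p).
Proof. by move=> ij p0; rewrite (sphere_mean_swap ij p0) (sphere_mean_square_snd ij p0). Qed.

End rot_eigen.

(* Moments of the uniform distribution on [0, 1]: T a b = B(a + 1, b + 1). *)
Lemma beta_recurrence (K : numFieldType) (T : nat -> nat -> K) :
  T 0%N 0%N = 1 -> (forall a b, T a.+1 b + T a b.+1 = T a b) ->
  (forall a b, b.+1%:R * T a.+1 b = a.+1%:R * T a b.+1) ->
  forall a b, T a b = (a`! * b`!)%:R / ((a + b).+1)`!%:R.
Proof.
move=> T0 TD TS.
have fn0 n : (n`!%:R : K) != 0 by rewrite pnatr_eq0 -lt0n fact_gt0.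
(* Eliminating [T a b.+1] between the two relations leaves a recursion in [a] alone; [step'] does
   the same in [b] along the row a = 0. *)
have step a b : T a.+1 b * (a + b).+2%:R = a.+1%:R * T a b.
  rewrite -(TD a b) [RHS]mulrDr -TS -mulrDl mulrC -natrD; congr (_%:R * _).
  by rewrite addSn addnS.
have step' b : T 0%N b.+1 * b.+2%:R = b.+1%:R * T 0%N b.
  by rewrite -(TD 0%N b) [RHS]mulrDr TS mul1r mulrC -natr1 mulrDl mul1r addrC.
have ST0 b : T 0%N b * (b.+1)`!%:R = b`!%:R.
  elim: b => [|b IH]; first by rewrite T0 mul1r.
  rewrite factS natrM mulrA step' -mulrA IH -natrM.
  by rewrite factS.
move=> a b; apply: (canRL (mulfK (fn0 _))).
elim: a => [|a IH]; first by rewrite ST0 fact0 mul1n.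
by rewrite addSn factS natrM mulrA step -mulrA IH -natrM mulnA -factS.
Qed.

(** * Moments on S^3 and S^2 *)

Section hopf_moments.
Variable R : realType.
Local Notation C := R[i].
Local Notation iC := ('i%C : C).

(** The complex coordinate of the plane (k, l) and, next, its conjugate: they diagonalize the
    rotation of that plane, with weights i and -i. *)
Definition zcoord (n : nat) (k l : 'I_n) : mpoly n C := mX k + iC *: mX l.
Definition zconj (n : nat) (k l : 'I_n) : mpoly n C := mX k - iC *: mX l.

Lemma sphere_meanMn d (p : mpoly d.+1 C) n : sphere_mean (p *+ n) = sphere_mean p *+ n.
Proof. by rewrite -scaler_nat sphere_meanZ mulr_natl. Qed.

Lemma rot_derivZ d (i j : 'I_d.+1) (c : C) p :
  rot_deriv i j (c *: p) = c *: rot_deriv i j p.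
Proof. by rewrite -!mpoly.mul_mpolyC rot_derivM rot_derivC mul0r add0r. Qed.

Lemma rot_derivB d (i j : 'I_d.+1) (p q : mpoly d.+1 C) :
  rot_deriv i j (p - q) = rot_deriv i j p - rot_deriv i j q.
Proof. by rewrite -scaleN1r rot_derivD rot_derivZ scaleN1r. Qed.

Lemma zcoord_eigen d (k l : 'I_d.+1) : k != l -> rot_eigen k l iC (zcoord k l).
Proof.
move=> kl; rewrite /rot_eigen rot_derivD rot_derivZ !rot_derivX !eqxx.
rewrite (eq_sym l) (negPf kl) sub0r subr0.
by rewrite /zcoord scalerDr scalerA -expr2 sqr_i scaleN1r addrC.
Qed.

Lemma zconj_eigen d (k l : 'I_d.+1) : k != l -> rot_eigen k l (- iC) (zconj k l).
Proof.
move=> kl; rewrite /rot_eigen rot_derivB rot_derivZ !rot_derivX !eqxx.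
rewrite (eq_sym l) (negPf kl) sub0r subr0.
by rewrite /zconj scalerBr scalerA mulNr -expr2 sqr_i opprK scale1r scaleNr addrC.
Qed.

Lemma rot_eigen_var d (i j k : 'I_d.+1) : k != i -> k != j ->
  rot_eigen i j 0 (mX k : mpoly d.+1 C).
Proof.
by move=> ki kj; rewrite /rot_eigen rot_derivX (negPf ki) (negPf kj) subrr scale0r.
Qed.

Lemma rot_eigenD d (i j : 'I_d.+1) (c : C) p q : rot_eigen i j c p ->
  rot_eigen i j c q -> rot_eigen i j c (p + q).
Proof. by rewrite /rot_eigen rot_derivD => -> ->; rewrite scalerDr. Qed.

Lemma rot_eigenZ d (i j : 'I_d.+1) (c a : C) p : rot_eigen i j c p ->
  rot_eigen i j c (a *: p).
Proof. by rewrite /rot_eigen rot_derivZ => ->; rewrite !scalerA mulrC. Qed.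

Lemma zcoord_eigen0 d (i j k l : 'I_d.+1) : k != i -> k != j -> l != i -> l != j ->
  rot_eigen i j 0 (zcoord k l).
Proof.
by move=> *; apply: rot_eigenD; [|apply: rot_eigenZ]; exact: rot_eigen_var.
Qed.

Lemma zconj_eigen0 d (i j k l : 'I_d.+1) : k != i -> k != j -> l != i -> l != j ->
  rot_eigen i j 0 (zconj k l).
Proof.
move=> *; rewrite /zconj -scaleNr.
by apply: rot_eigenD; [|apply: rot_eigenZ]; exact: rot_eigen_var.
Qed.

Lemma zcoord_zconj n (k l : 'I_n) : zcoord k l * zconj k l = mX k ^+ 2 + mX l ^+ 2.
Proof.
rewrite /zcoord /zconj mulrC -subr_sqr exprZn sqr_i scaleN1r opprK//.
Qed.

(** Used with [p], [q] replaced by their powers of exponents [a], [b], and [p'], [q'] by those of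
    exponents [a.-1], [b.-1]; in an abstract ring these are atoms. *)
Let rot_deriv_expand (K : comNzRingType) (x y p p' q q' : K) a b :
  ((0 - y) * y + x * (x - 0)) * (p * q) +
    x * y * (a%:R * p' * - (2 * (x * y)) * q + p * (b%:R * q' * (2 * (x * y)))) =
  x ^+ 2 * (p * q) - y ^+ 2 * (p * q) +
  ((x ^+ 2 * y ^+ 2 * (p * q')) *+ (2 * b) - (x ^+ 2 * y ^+ 2 * (p' * q)) *+ (2 * a)).
Proof. by rewrite -[_ *+ (2 * b)]mulr_natl -[_ *+ (2 * a)]mulr_natl !natrM; ring. Qed.

(** Doubling the first premise turns it into t1 - t2 + b t1 - a t2 = 0. *)
Let rot_deriv_solve (K : comNzRingType) (m1 m2 m3 m4 t1 t2 : K) a b :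
  m1 - m2 + (m3 *+ (2 * b) - m4 *+ (2 * a)) = 0 -> 2 * m1 = t1 -> 2 * m2 = t2 ->
  b%:R * (4 * m3) = b%:R * t1 -> a%:R * (4 * m4) = a%:R * t2 ->
  b.+1%:R * t1 = a.+1%:R * t2.
Proof.
move=> e0 e1 e2 e3 e4; apply/eqP; rewrite -subr_eq0; apply/eqP.
rewrite -(mulr0 2) -e0 -!natr1 !mulrDl -e3 -e4 !mul1r -e1 -e2.
by rewrite -[m3 *+ _]mulr_natl -[m4 *+ _]mulr_natl !natrM; ring.
Qed.

(** The rotation in the plane (k, j) mixes the two given planes. Its derivative of
    [mX k * mX j * (p ^+ a * q ^+ b)] has mean zero; invariance within each plane then replaces
    [mX k ^+ 2] by p/2 and [mX j ^+ 2] by q/2 under the mean. *)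
Lemma sphere_mean_swap_planes d (i k j l : 'I_d.+1) (p q : mpoly d.+1 C) a b :
  p = mX i ^+ 2 + mX k ^+ 2 -> q = mX j ^+ 2 + mX l ^+ 2 ->
  i != k -> j != l -> k != j -> i != j -> i != l -> k != l ->
  b.+1%:R * sphere_mean (p ^+ a.+1 * q ^+ b) =
  a.+1%:R * sphere_mean (p ^+ a * q ^+ b.+1).
Proof.
move=> pE qE ik jl kj ij il kl.
have pq_ik a' b' : rot_eigen i k 0 (p ^+ a' * q ^+ b').
  have ep : rot_eigen i k 0 p.
    rewrite pE -zcoord_zconj -(subrr iC).
    exact: (rot_eigenM (zcoord_eigen ik) (zconj_eigen ik)).
  have eq : rot_eigen i k 0 q.
    rewrite qE -zcoord_zconj -(addr0 0); apply: rot_eigenM.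
      by apply: zcoord_eigen0; rewrite // eq_sym.
    by apply: zconj_eigen0; rewrite // eq_sym.
  have := rot_eigenM (rot_eigenXn a' ep) (rot_eigenXn b' eq).
  by rewrite !mul0r addr0.
have pq_jl a' b' : rot_eigen j l 0 (p ^+ a' * q ^+ b').
  have ep : rot_eigen j l 0 p.
    rewrite pE -zcoord_zconj -(addr0 0); apply: rot_eigenM.
      by apply: zcoord_eigen0.
    by apply: zconj_eigen0.
  have eq : rot_eigen j l 0 q.
    rewrite qE -zcoord_zconj -(subrr iC).
    exact: (rot_eigenM (zcoord_eigen jl) (zconj_eigen jl)).
  have := rot_eigenM (rot_eigenXn a' ep) (rot_eigenXn b' eq).
  by rewrite !mul0r addr0.
pose T a' b' := sphere_mean (p ^+ a' * q ^+ b').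
have sqk a' b' : 2 * sphere_mean (mX k ^+ 2 * (p ^+ a' * q ^+ b')) = T a'.+1 b'.
  have := sphere_mean_square_snd ik (pq_ik a' b'); rewrite -pE => ->.
  by rewrite mulrA -exprS.
have sqj a' b' : 2 * sphere_mean (mX j ^+ 2 * (p ^+ a' * q ^+ b')) = T a' b'.+1.
  have := sphere_mean_square_fst jl (pq_jl a' b'); rewrite -qE => ->.
  by rewrite mulrCA -exprS.
have sqkj a' b' : 4 * sphere_mean (mX k ^+ 2 * mX j ^+ 2 * (p ^+ a' * q ^+ b')) =
    T a'.+1 b'.+1.
  (* The factor [mX k ^+ 2] keeps invariance in the plane (j, l), so [mX j ^+ 2] is averaged first
     and [mX k ^+ 2] after it. *)
  have epk : rot_eigen j l 0 (mX k ^+ 2 * (p ^+ a' * q ^+ b')).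
    have ek : rot_eigen j l 0 (mX k : mpoly d.+1 C) by exact: rot_eigen_var.
    have := rot_eigenM (rot_eigenXn 2 ek) (pq_jl a' b').
    by rewrite mul0r addr0.
  rewrite -sqk (_ : 4 = 2 * 2); last by rewrite -natrM.
  rewrite -mulrA; congr (_ * _).
  have := sphere_mean_square_fst jl epk; rewrite -qE => e.
  have -> : mX k ^+ 2 * mX j ^+ 2 * (p ^+ a' * q ^+ b') =
      mX j ^+ 2 * (mX k ^+ 2 * (p ^+ a' * q ^+ b')) by rewrite -mulrA mulrCA.
  rewrite e; congr sphere_mean.
  by rewrite mulrCA; congr (_ * _); rewrite mulrCA -exprS.
have dp : rot_deriv k j p = - (2 * (mX k * mX j)).
  rewrite pE rot_derivD !rot_derivXn !rot_derivX !eqxx (negPf kj) (negPf ij).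
  by rewrite (negPf ik) /=; ring.
have dq : rot_deriv k j q = 2 * (mX k * mX j).
  rewrite qE rot_derivD !rot_derivXn !rot_derivX !eqxx ![_ == k]eq_sym.
  by rewrite (negPf kj) (negPf kl) (eq_sym l) (negPf jl) /=; ring.
have := sphere_mean_rot_deriv (mX k * mX j * (p ^+ a * q ^+ b)) kj.
rewrite !rot_derivM !rot_derivXn dp dq !rot_derivX !eqxx (negPf kj) (eq_sym j).
rewrite (negPf kj).
rewrite rot_deriv_expand sphere_meanD 2!sphere_meanB !sphere_meanMn => e0.
(* At a = 0 the exponent [a.-1] is truncated, and the factor [a] saves the identity. *)
have ea : a%:R * (4 * sphere_mean (mX k ^+ 2 * mX j ^+ 2 * (p ^+ a.-1 * q ^+ b))) =
    a%:R * T a b.+1.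
  by case: (a) => [|a']; [rewrite !mul0r|congr (_ * _); exact: sqkj].
have eb : b%:R * (4 * sphere_mean (mX k ^+ 2 * mX j ^+ 2 * (p ^+ a * q ^+ b.-1))) =
    b%:R * T a.+1 b.
  by case: (b) => [|b']; [rewrite !mul0r|congr (_ * _); exact: sqkj].
exact: (rot_deriv_solve e0 (sqk a b) (sqj a b) eb ea).
Qed.

Let e0 : 'I_4 := @Ordinal 4 0 isT.
Let e1 : 'I_4 := @Ordinal 4 1 isT.
Let e2 : 'I_4 := @Ordinal 4 2 isT.
Let e3 : 'I_4 := @Ordinal 4 3 isT.

Let z1 : mpoly 4 C := zcoord e0 e1.
Let w1 : mpoly 4 C := zconj e0 e1.
Let z2 : mpoly 4 C := zcoord e2 e3.
Let w2 : mpoly 4 C := zconj e2 e3.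

(** These monomials span all polynomials on R^4; a unit scalar c acting on C^2 multiplies this one
    by c^(a + b - a' - b'). *)
Definition zmonom (a a' b b' : nat) : mpoly 4 C :=
  z1 ^+ a * w1 ^+ a' * (z2 ^+ b * w2 ^+ b').

Let o01 : e0 != e1. Proof. by []. Qed.
Let o23 : e2 != e3. Proof. by []. Qed.

Let iC_neq0 : iC != 0.
Proof. by rewrite eq_complex/= oner_eq0 andbF. Qed.

Let pow_eigen d (i j : 'I_d.+1) (p q : mpoly d.+1 C) a b :
  rot_eigen i j iC p -> rot_eigen i j (- iC) q ->
  rot_eigen i j (iC * (a%:R - b%:R)) (p ^+ a * q ^+ b).
Proof.
move=> ep eq; rewrite mulrBr -mulNr.
by apply: rot_eigenM; exact: rot_eigenXn.
Qed.

Let pow_eigen0 d (i j : 'I_d.+1) (p q : mpoly d.+1 C) a b :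
  rot_eigen i j 0 p -> rot_eigen i j 0 q -> rot_eigen i j 0 (p ^+ a * q ^+ b).
Proof.
move=> ep eq; have := rot_eigenM (rot_eigenXn a ep) (rot_eigenXn b eq).
by rewrite !mul0r addr0.
Qed.

(** The weights are i(a - a') in the first plane and i(b - b') in the second, and one of them is
    nonzero. *)
Lemma sphere_mean_zmonom_neq a a' b b' : (a != a') || (b != b') ->
  sphere_mean (zmonom a a' b b') = 0.
Proof.
move=> /orP[|] neq.
- apply: (sphere_mean_rot_eigen (c := iC * (a%:R - a'%:R)) o01).
    by rewrite mulf_neq0// subr_eq0 eqr_nat.
  rewrite -[X in rot_eigen _ _ X]addr0; apply: rot_eigenM.
    by apply: pow_eigen; [exact: (zcoord_eigen o01)|exact: (zconj_eigen o01)].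
  by apply: pow_eigen0; [exact: zcoord_eigen0|exact: zconj_eigen0].
- apply: (sphere_mean_rot_eigen (c := iC * (b%:R - b'%:R)) o23).
    by rewrite mulf_neq0// subr_eq0 eqr_nat.
  rewrite -[X in rot_eigen _ _ X]add0r; apply: rot_eigenM.
    by apply: pow_eigen0; [exact: zcoord_eigen0|exact: zconj_eigen0].
  by apply: pow_eigen; [exact: (zcoord_eigen o23)|exact: (zconj_eigen o23)].
Qed.

(** Here p = |z|^2 and q = |w|^2 add up to 1 on S^3, and [sphere_mean_swap_planes] gives the other
    relation: |z|^2 has the moments of a uniform variable. *)
Lemma sphere_mean_zmonom_eq a b :
  sphere_mean (zmonom a a b b) = (a`! * b`!)%:R / ((a + b).+1)`!%:R.
Proof.
have [p pE] : exists p, p = mX e0 ^+ 2 + mX e1 ^+ 2 :> mpoly 4 C by eexists.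
have [q qE] : exists q, q = mX e2 ^+ 2 + mX e3 ^+ 2 :> mpoly 4 C by eexists.
have -> : zmonom a a b b = p ^+ a * q ^+ b.
  by rewrite /zmonom -!exprMn !zcoord_zconj pE qE.
apply: (beta_recurrence (T := fun a b => sphere_mean (p ^+ a * q ^+ b))).
- by rewrite !expr0 mulr1 sphere_mean1.
- move=> {}a {}b; rewrite -sphere_meanD -[RHS]sphere_mean_radial.
  have -> : \sum_(i < 4) (mX i : mpoly 4 C) ^+ 2 = p + q.
    rewrite pE qE !big_ord_recl big_ord0 addr0 !addrA.
    by congr (mX _ ^+ 2 + mX _ ^+ 2 + mX _ ^+ 2 + mX _ ^+ 2); apply/val_inj.
  by congr sphere_mean; rewrite mulrDl !exprS !mulrA [q * _]mulrC.
- by move=> {}a {}b; exact: (sphere_mean_swap_planes _ _ pE qE).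
Qed.

End hopf_moments.

(** * Moments of the Hopf coordinates on S^2 *)

Section hopf_base.
Variable R : realType.
Local Notation C := R[i].

Let f0 : 'I_3 := @Ordinal 3 0 isT.
Let f1 : 'I_3 := @Ordinal 3 1 isT.
Let f2 : 'I_3 := @Ordinal 3 2 isT.

(** These four give, at a point of S^2, the values of |z|^2, |w|^2, z w^* and its conjugate along
    the fibre above it. *)
Definition hopf_u : mpoly 3 C := 2^-1 *: (1 + mX f2).
Definition hopf_v : mpoly 3 C := 2^-1 *: (1 - mX f2).
Definition hopf_xi : mpoly 3 C := 2^-1 *: zcoord R f0 f1.
Definition hopf_xibar : mpoly 3 C := 2^-1 *: zconj R f0 f1.

Let hopf_uv_eigen a b : rot_eigen f0 f1 0 (hopf_u ^+ a * hopf_v ^+ b).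
Proof.
have e2 : rot_eigen f0 f1 0 (mX f2 : mpoly 3 C) by exact: rot_eigen_var.
have eu : rot_eigen f0 f1 0 hopf_u.
  by apply: rot_eigenZ; apply: rot_eigenD e2; exact: rot_eigen1.
have ev : rot_eigen f0 f1 0 hopf_v.
  apply: rot_eigenZ; apply: rot_eigenD; first exact: rot_eigen1.
  by rewrite -scaleN1r; exact: rot_eigenZ.
have := rot_eigenM (rot_eigenXn a eu) (rot_eigenXn b ev).
by rewrite !mul0r addr0.
Qed.

Let rot_deriv_expand (K : comNzRingType) (h x c p p' q q' : K) a b :
  (0 - h) * (p * q) +
    x * (a%:R * p' * (c * x) * q + p * (b%:R * q' * - (c * x))) =
  c * (x ^+ 2 * (p' * q)) *+ a - c * (x ^+ 2 * (p * q')) *+ b - h * (p * q).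
Proof. by rewrite -[_ *+ a]mulr_natl -[_ *+ b]mulr_natl; ring. Qed.

Let rot_deriv_solve (K : numFieldType) (m3 m4 t1 t2 : K) a b :
  2^-1 * m3 *+ a - 2^-1 * m4 *+ b - (t1 - t2) = 0 ->
  a%:R * m3 = a%:R * (2 * t2) -> b%:R * m4 = b%:R * (2 * t1) ->
  b.+1%:R * t1 = a.+1%:R * t2.
Proof.
rewrite -[_ *+ a]mulr_natl -[_ *+ b]mulr_natl => e0 e3 e4.
rewrite (mulrCA a%:R) e3 (mulrCA b%:R) e4 in e0.
apply/eqP; rewrite -subr_eq0; apply/eqP; rewrite -[RHS]oppr0 -e0 -!natr1.
by field.
Qed.

(** Archimedes: the height is uniformly distributed, hence so is u. As u + v = 1, u - v is the
    height and the squares of the other two coordinates add up to 4uv, the rotation in the plane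
    (f1, f2) applied to [mX f1 * (u ^+ a * v ^+ b)] yields the same recurrence as on S^3. *)
Lemma sphere_mean_hopf_uv a b :
  sphere_mean (hopf_u ^+ a * hopf_v ^+ b) = (a`! * b`!)%:R / ((a + b).+1)`!%:R.
Proof.
have [u uE] : exists u, u = hopf_u by eexists.
have [v vE] : exists v, v = hopf_v by eexists.
have two0 : (2 : C) != 0 by rewrite pnatr_eq0.
have e01 : f0 != f1 by []. have e12 : f1 != f2 by [].
have uv1 : u + v = 1.
  rewrite uE vE -scalerDr addrACA subrr addr0 [X in _ *: X](_ : _ = 2 *: 1).
    by rewrite scalerA mulVf ?scale1r.
  by rewrite scaler_nat.
have uvB : u - v = mX f2.
  rewrite uE vE -scalerBr opprB addrACA [X in _ *: X](_ : _ = 2 *: mX f2).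
    by rewrite scalerA mulVf ?scale1r.
  by rewrite scaler_nat mulr2n [1 + _]addrC; ring.
have uvM : 1 - mX f2 ^+ 2 = 4 *: (u * v).
  rewrite uE vE -scalerAl -scalerAr !scalerA (_ : 4 * 2^-1 * 2^-1 = 1 :> C); last by field.
  by rewrite scale1r mulrC -subr_sqr expr1n.
have uv01 a' b' : rot_eigen f0 f1 0 (u ^+ a' * v ^+ b').
  by rewrite uE vE; exact: hopf_uv_eigen.
pose T a b := sphere_mean (u ^+ a * v ^+ b).
have x01 : mX f0 ^+ 2 + mX f1 ^+ 2 = \sum_(i < 3) (mX i : mpoly 3 C) ^+ 2 - mX f2 ^+ 2.
  rewrite !big_ord_recl big_ord0 addr0 addrA.
  rewrite (_ : lift ord0 (lift ord0 ord0) = f2) ?addrK; last exact/val_inj.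
  by congr (mX _ ^+ 2 + mX _ ^+ 2); apply/val_inj.
have sq a' b' : sphere_mean (mX f1 ^+ 2 * (u ^+ a' * v ^+ b')) = 2 * T a'.+1 b'.+1.
  apply: (mulfI two0); apply: etrans (sphere_mean_square_snd e01 (uv01 a' b')) _.
  rewrite x01 mulrBl sphere_meanB sphere_mean_radial -sphere_meanB.
  rewrite -[X in X - _]mul1r -mulrBl uvM -scalerAl sphere_meanZ mulrACA -!exprS.
  by rewrite [RHS]mulrA; congr (_ * _); rewrite -natrM.
have du : rot_deriv f1 f2 u = (2^-1)%:MP * mX f1.
  rewrite uE rot_derivZ rot_derivD -mpoly.mpolyC1 rot_derivC rot_derivX.
  by rewrite mpoly.mul_mpolyC add0r subr0.
have dv : rot_deriv f1 f2 v = - ((2^-1)%:MP * mX f1).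
  rewrite vE rot_derivZ rot_derivB -mpoly.mpolyC1 rot_derivC rot_derivX.
  by rewrite mpoly.mul_mpolyC sub0r subr0 scalerN.
rewrite -uE -vE.
apply: (beta_recurrence (T := T)); rewrite /T.
- by rewrite !expr0 mulr1 sphere_mean1.
- move=> {}a {}b; rewrite -sphere_meanD; congr sphere_mean.
  by rewrite !exprS -mulrA [X in _ + X]mulrCA -mulrDl uv1 mul1r.
- move=> {}a {}b.
  have := sphere_mean_rot_deriv (mX f1 * (u ^+ a * v ^+ b)) e12.
  rewrite !rot_derivM !rot_derivXn du dv rot_derivX /= rot_deriv_expand.
  rewrite 2!sphere_meanB !sphere_meanMn !mpoly.mul_mpolyC !sphere_meanZ => e0.
  have eh : sphere_mean (mX f2 * (u ^+ a * v ^+ b)) = T a.+1 b - T a b.+1.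
    rewrite -uvB mulrBl sphere_meanB mulrA -exprS; congr (_ - sphere_mean _).
    by rewrite mulrCA -exprS.
  rewrite eh in e0; apply: (rot_deriv_solve e0).
    by case: (a) => [|a']; [rewrite !mul0r|congr (_ * _); exact: sq].
  by case: (b) => [|b']; [rewrite !mul0r|congr (_ * _); exact: sq].
Qed.

(* The truncated subtractions select the power of xi or of its conjugate. *)
Definition hopf_poly a a' b b' : mpoly 3 C :=
  hopf_u ^+ minn a a' * hopf_v ^+ minn b b' *
  (hopf_xi ^+ (a - a') * hopf_xibar ^+ (a' - a)).

(** If a = a' then b = b', and both sides are the same beta value. Otherwise both vanish, each
    having a nonzero weight under a coordinate rotation. *)
Lemma sphere_mean_hopf_poly a a' b b' : (a + b = a' + b')%N ->
  sphere_mean (hopf_poly a a' b b') = sphere_mean (zmonom R a a' b b').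
Proof.
move=> ab; have [aa'|aa'] := eqVneq a a'.
  move: ab; rewrite -aa' => /addnI <-.
  rewrite sphere_mean_zmonom_eq -sphere_mean_hopf_uv.
  by rewrite /hopf_poly !minnn subnn !expr0 !mulr1.
rewrite sphere_mean_zmonom_neq ?aa'//.
have e01 : f0 != f1 by [].
pose c : C := 'i%C * (a - a')%:R + - 'i%C * (a' - a)%:R.
apply: (sphere_mean_rot_eigen (c := c) e01).
  rewrite /c mulNr -mulrBr mulf_neq0//.
    by rewrite eq_complex/= oner_eq0 andbF.
  by rewrite subr_eq0 eqr_nat; lia.
rewrite -[c]add0r; apply: rot_eigenM; first exact: hopf_uv_eigen.
apply: rot_eigenM; apply: rot_eigenXn; apply: rot_eigenZ.
  exact: zcoord_eigen.
exact: zconj_eigen.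
Qed.

Lemma msizeM_leq n (p q : mpoly n C) k l :
  (mpoly.msize p <= k.+1)%N -> (mpoly.msize q <= l.+1)%N ->
  (mpoly.msize (p * q) <= (k + l).+1)%N.
Proof.
have [->|p0] := eqVneq p 0; first by rewrite mul0r mpoly.msize0.
have [->|q0] := eqVneq q 0; first by rewrite mulr0 mpoly.msize0.
rewrite mpoly.msizeM//; move: (mpoly.msize p) (mpoly.msize q) => x y xk yl.
lia.
Qed.

Lemma msizeXn_leq n (p : mpoly n C) k :
  (mpoly.msize p <= 2)%N -> (mpoly.msize (p ^+ k) <= k.+1)%N.
Proof.
move=> p2; elim: k => [|k IH]; first by rewrite expr0 mpoly.msize1.
by rewrite exprS; exact: (msizeM_leq p2 IH).
Qed.

(** Half the degree of the monomial on S^3: a coordinate and a conjugate pair off into one Hopf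
    coordinate, of degree 1. *)
Lemma msize_hopf_poly a a' b b' : (a + b = a' + b')%N ->
  (mpoly.msize (hopf_poly a a' b b') <= (a + b).+1)%N.
Proof.
move=> ab.
have mX2 i : (mpoly.msize (mX i : mpoly 3 C) <= 2)%N by rewrite mpoly.msizeX mpoly.mdeg1.
have mD (p q : mpoly 3 C) : (mpoly.msize p <= 2 -> mpoly.msize q <= 2 ->
    mpoly.msize (p + q) <= 2)%N.
  by move=> p2 q2; apply: leq_trans (mpoly.msizeD_le _ _) _; rewrite geq_max p2.
have mZ c (p : mpoly 3 C) : (mpoly.msize p <= 2 -> mpoly.msize (c *: p) <= 2)%N.
  by apply: leq_trans; exact: mpoly.msizeZ_le.
have m1 : (mpoly.msize (1 : mpoly 3 C) <= 2)%N by rewrite mpoly.msize1.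
have du : (mpoly.msize hopf_u <= 2)%N by exact/mZ/mD.
have dv : (mpoly.msize hopf_v <= 2)%N.
  by apply/mZ/mD => //; rewrite -scaleN1r; exact/mZ.
have dx : (mpoly.msize hopf_xi <= 2)%N by apply/mZ/mD => //; exact/mZ.
have dxb : (mpoly.msize hopf_xibar <= 2)%N.
  by apply/mZ/mD => //; rewrite -scaleNr; exact/mZ.
have := msizeM_leq
  (msizeM_leq (msizeXn_leq (minn a a') du) (msizeXn_leq (minn b b') dv))
  (msizeM_leq (msizeXn_leq (a - a') dx) (msizeXn_leq (a' - a) dxb)).
by move/leq_trans; apply; lia.
Qed.

End hopf_base.

(** * Lifting a design along the Hopf map *)

Section lift.
Variable R : realType.
Local Notation C := R[i].

Definition c2point (z w : C) : euclid R 4 :=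
  [tuple of [:: complex.Re z : measurableTypeR R; complex.Im z; complex.Re w; complex.Im w]].

Let e0 : 'I_4 := @Ordinal 4 0 isT.
Let e1 : 'I_4 := @Ordinal 4 1 isT.
Let e2 : 'I_4 := @Ordinal 4 2 isT.
Let e3 : 'I_4 := @Ordinal 4 3 isT.
Let f0 : 'I_3 := @Ordinal 3 0 isT.
Let f1 : 'I_3 := @Ordinal 3 1 isT.
Let f2 : 'I_3 := @Ordinal 3 2 isT.

Lemma cpoly_evalXn d (p : mpoly d.+1 C) n x :
  cpoly_eval (p ^+ n) x = cpoly_eval p x ^+ n.
Proof. exact: rmorphXn. Qed.

Lemma cpoly_eval1 d x : cpoly_eval (1 : mpoly d.+1 C) x = 1.
Proof. exact: mpoly.meval1. Qed.

Lemma cpoly_eval_zcoord d (k l : 'I_d.+1) x :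
  cpoly_eval (zcoord R k l) x = (tnth x k : R) +i* tnth x l.
Proof.
rewrite cpoly_evalD cpoly_evalZ !cpoly_evalX.
by rewrite [RHS]complexE.
Qed.

Lemma cpoly_eval_zconj d (k l : 'I_d.+1) x :
  cpoly_eval (zconj R k l) x = ((tnth x k : R) +i* tnth x l)^*%C.
Proof.
rewrite cpoly_evalB cpoly_evalZ !cpoly_evalX.
by rewrite [RHS]complexE /= rmorphN mulrN.
Qed.

Lemma cpoly_eval_zmonom a a' b b' (z w : C) :
  cpoly_eval (zmonom R a a' b b') (c2point z w) =
  z ^+ a * z^*%C ^+ a' * (w ^+ b * w^*%C ^+ b').
Proof.
rewrite !cpoly_evalM !cpoly_evalXn !cpoly_eval_zcoord !cpoly_eval_zconj.
by case: z w => [? ?] [? ?].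
Qed.

Lemma c2point_sphere z w : z * z^*%C + w * w^*%C = 1 -> sphere (c2point z w).
Proof.
move=> zw; rewrite /sphere /= /enorm -[RHS]sqrtr1; congr Num.sqrt.
rewrite !big_ord_recl big_ord0 addr0 !(tnth_nth 0) /=.
have := congr1 (@complex.Re R) zw; case: z w {zw} => [a b] [c d] /= <-; ring.
Qed.

Lemma c2point_inj z w z' w' : c2point z w = c2point z' w' -> z = z' /\ w = w'.
Proof.
by move/(congr1 val) => /= []; case: z w z' w' => [? ?] [? ?] [? ?] [? ?] /= -> -> -> ->.
Qed.

(** Stated through the Hopf polynomials, so that invariant monomials are evaluated by
    substitution. *)
Definition is_lift (y : euclid R 3) (z w : C) :=
  [/\ z * z^*%C = cpoly_eval (hopf_u R) y, w * w^*%C = cpoly_eval (hopf_v R) y &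
      z * w^*%C = cpoly_eval (hopf_xi R) y].

Let half : (2^-1 : C) = (2^-1 : R)%:C.
Proof. by rewrite fmorphV/= rmorph_nat. Qed.

Lemma cpoly_eval_hopf_u y :
  cpoly_eval (hopf_u R) y = (2^-1 * (1 + (tnth y f2 : R)))%:C.
Proof.
rewrite cpoly_evalZ cpoly_evalD cpoly_eval1 cpoly_evalX.
by rewrite half rmorphM rmorphD.
Qed.

Lemma cpoly_eval_hopf_v y :
  cpoly_eval (hopf_v R) y = (2^-1 * (1 - (tnth y f2 : R)))%:C.
Proof.
rewrite cpoly_evalZ cpoly_evalB cpoly_eval1 cpoly_evalX.
by rewrite half rmorphM rmorphB.
Qed.

Lemma cpoly_eval_hopf_xi y :
  cpoly_eval (hopf_xi R) y = 2^-1 * ((tnth y f0 : R) +i* tnth y f1).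
Proof. by rewrite cpoly_evalZ cpoly_eval_zcoord. Qed.

Lemma cpoly_eval_hopf_xibar y :
  cpoly_eval (hopf_xibar R) y = (cpoly_eval (hopf_xi R) y)^*%C.
Proof.
by rewrite cpoly_eval_hopf_xi cpoly_evalZ cpoly_eval_zconj half rmorphM/= oppr0.
Qed.

(** With height h > -1, take z = sqrt((1 + h)/2) real and w the conjugate of xi divided by z. At the
    pole h = -1, z must vanish and (0, 1) is taken. *)
Lemma exists_lift y : sphere y -> exists z w, is_lift y z w.
Proof.
move=> yS.
have y2 : (tnth y f0 : R) ^+ 2 + tnth y f1 ^+ 2 = 1 - tnth y f2 ^+ 2.
  have : Num.sqrt (\sum_(i < 3) (tnth y i : R) ^+ 2) = 1 by [].
  move/(congr1 (fun r => r ^+ 2)); rewrite expr1n sqr_sqrtr; last first.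
    by apply: sumr_ge0 => i _; exact: sqr_ge0.
  rewrite !big_ord_recl big_ord0 addr0 addrA => <-.
  rewrite (_ : lift ord0 (lift ord0 ord0) = f2) ?addrK; last exact/val_inj.
  by congr (tnth y _ ^+ 2 + tnth y _ ^+ 2); apply/val_inj.
rewrite /is_lift cpoly_eval_hopf_u cpoly_eval_hopf_v cpoly_eval_hopf_xi.
move: (tnth y f0 : R) (tnth y f1 : R) (tnth y f2 : R) y2 => r s h y2 {y yS}.
have [h1|h1] := eqVneq h (-1).
  have /andP[/eqP -> /eqP ->] : (r == 0) && (s == 0).
    rewrite -(sqrf_eq0 r) -(sqrf_eq0 s) -paddr_eq0 ?sqr_ge0//.
    by rewrite y2 h1 sqrrN expr1n subrr.
  exists 0, 1; rewrite !mul0r mul1r conjc1 h1 subrr mulr0 opprK; split => //.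
    by rewrite mulVf// pnatr_eq0.
  by rewrite -[0 +i* 0]/(0 : C) mulr0.
have hp : 0 < 1 + h.
  have : 0 <= 1 - h ^+ 2 by rewrite -y2 addr_ge0 ?sqr_ge0.
  have h1' : 1 + h != 0 by rewrite addrC addr_eq0.
  by rewrite lt_def h1'/= => hh; rewrite leNgt; apply/negP => ?; nra.
pose al := Num.sqrt (2^-1 * (1 + h)).
have al0 : 0 < al by rewrite sqrtr_gt0 mulr_gt0// invr_gt0.
have al2 : al ^+ 2 = 2^-1 * (1 + h) by rewrite sqr_sqrtr// mulr_ge0 ?invr_ge0// ltW.
exists al%:C, (r / (2 * al) -i* (s / (2 * al))); split.
- by rewrite conjc_real -rmorphM -expr2 al2.
- apply/eqP; rewrite eq_complex/=; apply/andP; split; apply/eqP; last by ring.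
  have -> : 2^-1 * (1 - h) = (r ^+ 2 + s ^+ 2) / (4 * al ^+ 2).
    by rewrite y2 al2; field; rewrite gt_eqF.
  by field; rewrite gt_eqF.
- rewrite half; apply/eqP; rewrite eq_complex/= opprK; apply/andP.
  by split; apply/eqP; field; rewrite gt_eqF.
Qed.

(** Fibres are disjoint: xi determines the first two coordinates and u the third. *)
Lemma is_lift_inj y y' z w : is_lift y z w -> is_lift y' z w -> y = y'.
Proof.
move=> [u _ x] [u' _ x'].
have : cpoly_eval (hopf_u R) y = cpoly_eval (hopf_u R) y' by rewrite -u.
have : cpoly_eval (hopf_xi R) y = cpoly_eval (hopf_xi R) y' by rewrite -x.
rewrite !cpoly_eval_hopf_xi !cpoly_eval_hopf_u => xe /complexI ue.
have two0 : (2^-1 : C) != 0 by rewrite invr_eq0 pnatr_eq0.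
have [x0 x1] := mulfI two0 xe.
have twoR : (2^-1 : R) != 0 by rewrite invr_eq0 pnatr_eq0.
have x2 : tnth y f2 = tnth y' f2 by apply: (@addrI R 1); exact: mulfI twoR _ _ ue.
apply/eq_from_tnth => -[[|[|[|//]]] k3].
- by rewrite (_ : Ordinal k3 = f0)//; exact/val_inj.
- by rewrite (_ : Ordinal k3 = f1)//; exact/val_inj.
- by rewrite (_ : Ordinal k3 = f2)//; exact/val_inj.
Qed.

Lemma is_liftM y z w c : c * c^*%C = 1 -> is_lift y z w -> is_lift y (c * z) (c * w).
Proof.
have E (x x' : C) : c * c^*%C = 1 -> c * x * (c * x')^*%C = x * x'^*%C.
  by move=> c1; rewrite rmorphM mulrACA c1 mul1r.
by move=> c1 [u v x]; split; rewrite E.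
Qed.

(** The squared moduli add up to 1. Hence scalars act freely on a fibre. *)
Lemma is_lift_neq0 y z w : is_lift y z w -> (z != 0) || (w != 0).
Proof.
move=> [u v _]; rewrite -negb_and; apply/negP => /andP[/eqP z0 /eqP w0].
move: u v; rewrite z0 w0 !mul0r cpoly_eval_hopf_u cpoly_eval_hopf_v => -[u] [v].
have : (2^-1 * (1 + tnth y f2) + 2^-1 * (1 - tnth y f2)) = 1 :> R by field.
by rewrite -u -v addr0 => /esym/eqP; rewrite oner_eq0.
Qed.

Lemma is_lift_sphere y z w : is_lift y z w -> sphere (c2point z w).
Proof.
move=> [u v _]; apply: c2point_sphere; rewrite u v.
rewrite cpoly_eval_hopf_u cpoly_eval_hopf_v -rmorphD -[RHS]/(1%:C).
by congr (_%:C); field.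
Qed.

Let expr_balanced (K : comNzRingType) (x x' y y' : K) m n k l :
  x ^+ (m + k) * x' ^+ (m + l) * (y ^+ (n + l) * y' ^+ (n + k)) =
  (x * x') ^+ m * (y * y') ^+ n * ((x * y') ^+ k * (x' * y) ^+ l).
Proof.
rewrite !exprD !exprMn.
move: (x ^+ m) (x ^+ k) (x' ^+ m) (x' ^+ l) (y ^+ n) (y ^+ l) (y' ^+ n) (y' ^+ k).
by move=> *; ring.
Qed.

(** Pair off min(a, a') factors z z^* and min(b, b') factors w w^*; by balance, what remains is a
    power of z w^* or of its conjugate. *)
Lemma is_lift_zmonom y z w a a' b b' : is_lift y z w -> (a + b = a' + b')%N ->
  z ^+ a * z^*%C ^+ a' * (w ^+ b * w^*%C ^+ b') = cpoly_eval (hopf_poly R a a' b b') y.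
Proof.
move=> [u v x] ab.
rewrite !cpoly_evalM !cpoly_evalXn cpoly_eval_hopf_xibar -u -v -x.
have -> : (z * w^*%C)^*%C = z^*%C * w by rewrite rmorphM/= conjcK.
have aE : a = (minn a a' + (a - a'))%N by lia.
have a'E : a' = (minn a a' + (a' - a))%N by lia.
have bE : b = (minn b b' + (a' - a))%N by lia.
have b'E : b' = (minn b b' + (a - a'))%N by lia.
by rewrite -expr_balanced -aE -a'E -bE -b'E.
Qed.

End lift.

(** * Roots of unity and their orbits on S^3 *)

Lemma complex_prim_root_exists (R : realType) n : (n > 0)%N ->
  exists z : R[i], n.-primitive_root z.
Proof.
move=> n_gt0; pose p : {poly R[i]} := 'X^n - 1.
have [r Dp] := closed_field_poly_normal p.
rewrite (monicP _) ?monicXnsubC // scale1r in Dp.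
have rn1 : all n.-unity_root r by apply/allP => z; rewrite -root_prod_XsubC -Dp.
have sz_r : (n < (size r).+1)%N.
  by rewrite -(size_prod_XsubC r id) -Dp size_XnsubC.
(* Among n distinct n-th roots of unity one is primitive; they are distinct because X^n - 1 is
   separable in characteristic 0. *)
have [|z] := hasP (cyclic.has_prim_root n_gt0 rn1 _ sz_r); last by exists z.
by rewrite -separable.separable_prod_XsubC -Dp cyclotomic.separable_Xn_sub_1 // pnatr_eq0 -lt0n.
Qed.

Section orbit.
Variables (R : realType) (s : nat) (om : R[i]).
Local Notation C := R[i].
Hypothesis om_prim : s.+1.-primitive_root om.

Lemma prim_root_mul_conj : om * om^*%C = 1.
Proof.
have : `|om| ^+ s.+1 = 1 by rewrite -normrX (prim_expr_order om_prim) normr1.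
move/eqP; rewrite pexpr_eq1// => /eqP om1.
by rewrite -sqr_normc om1 expr1n.
Qed.

Lemma conj_prim_root : om^*%C = om^-1.
Proof.
have om0 : om != 0 by rewrite (prim_root_eq0 om_prim).
by apply: (mulfI om0); rewrite prim_root_mul_conj divff.
Qed.

Lemma orbit_mul_conj k : om ^+ k * (om ^+ k)^*%C = 1.
Proof. by rewrite rmorphXn/= -exprMn prim_root_mul_conj expr1n. Qed.

Let zmonom_scale (K : comNzRingType) (x y z z' w w' : K) a a' b b' :
  (x * z) ^+ a * (y * z') ^+ a' * ((x * w) ^+ b * (y * w') ^+ b') =
  x ^+ (a + b) * y ^+ (a' + b') * (z ^+ a * z' ^+ a' * (w ^+ b * w' ^+ b')).
Proof.
rewrite !exprD !exprMn.
move: (x ^+ a) (x ^+ b) (y ^+ a') (y ^+ b') (z ^+ a) (z' ^+ a') (w ^+ b) (w' ^+ b').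
by move=> *; ring.
Qed.

(** The k-th orbit point contributes r^k times the value at (z, w), with r = om^(a + b - a' - b'),
    so the sum is geometric. The degree bound keeps both exponents below the order s + 1 of [om], so
    r = 1 exactly in the balanced case. *)
Lemma sum_orbit_zmonom a a' b b' (z w : C) : (a + a' + b + b' <= s)%N ->
  \sum_(k < s.+1) cpoly_eval (zmonom R a a' b b') (c2point (om ^+ k * z) (om ^+ k * w)) =
  if (a + b == a' + b')%N then
    s.+1%:R * (z ^+ a * z^*%C ^+ a' * (w ^+ b * w^*%C ^+ b')) else 0.
Proof.
move=> deg; set E := z ^+ a * _ * _.
pose r := om ^+ (a + b) * om^-1 ^+ (a' + b').
have termE (k : 'I_s.+1) :
    cpoly_eval (zmonom R a a' b b') (c2point (om ^+ k * z) (om ^+ k * w)) = r ^+ k * E.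
  rewrite cpoly_eval_zmonom !rmorphM/= !rmorphXn/= conj_prim_root.
  have -> : r ^+ k = (om ^+ k) ^+ (a + b) * (om^-1 ^+ k) ^+ (a' + b').
    by rewrite /r exprMn -!exprM ![(k * _)%N]mulnC.
  exact: zmonom_scale.
rewrite (eq_bigr _ (fun k _ => termE k)) -mulr_suml.
have om0 : om != 0 by rewrite (prim_root_eq0 om_prim).
case: ifPn => [/eqP ab|ab].
  have -> : r = 1 by rewrite /r -ab -exprMn divff// expr1n.
  under eq_bigr do rewrite expr1n.
  by rewrite sumr_const card_ord.
have r1 : r != 1.
  apply: contraNneq ab => r1.
  have : om ^+ (a + b) == om ^+ (a' + b').
    apply/eqP; rewrite -[RHS]mul1r -r1 /r -mulrA -exprMn mulVf// expr1n mulr1//.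
  by rewrite (eq_prim_root_expr om_prim) !modn_small//; lia.
have rN : r ^+ s.+1 = 1.
  by rewrite /r exprMn -!exprM ![(_ * s.+1)%N]mulnC !exprM exprVn
    (prim_expr_order om_prim) invr1 !expr1n mulr1.
have /eqP := subrX1 r s.+1.
rewrite rN subrr eq_sym mulf_eq0 subr_eq0 (negPf r1) /= => /eqP ->.
by rewrite mul0r.
Qed.

End orbit.

(** * The union of the orbits over a design is a design *)

Section lift_design.
Variables (R : realType) (t s : nat) (om : R[i]) (X : {fset euclid R 3}).
Local Notation C := R[i].
Hypothesis om_prim : s.+1.-primitive_root om.
Hypothesis dX : is_design t X.
Hypothesis st : (s <= 2 * t + 1)%N.
Variable f : euclid R 3 -> C * C.
Hypothesis fP : forall y, sphere y -> is_lift y (f y).1 (f y).2.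

Let e0 : 'I_4 := @Ordinal 4 0 isT.
Let e1 : 'I_4 := @Ordinal 4 1 isT.
Let e2 : 'I_4 := @Ordinal 4 2 isT.
Let e3 : 'I_4 := @Ordinal 4 3 isT.

Let pt (y : euclid R 3) (k : nat) : euclid R 4 :=
  c2point (om ^+ k * (f y).1) (om ^+ k * (f y).2).

Let pt_lift y k : sphere y -> is_lift y (om ^+ k * (f y).1) (om ^+ k * (f y).2).
Proof. by move=> yS; apply: is_liftM; [exact: (orbit_mul_conj om_prim)|exact: fP]. Qed.

(** Disjoint fibres give y = y'; cancelling a nonzero coordinate then leaves equal powers of [om]
    with exponents below its order. *)
Let pt_inj y y' (k k' : 'I_s.+1) : sphere y -> sphere y' ->
  pt y k = pt y' k' -> y = y' /\ k = k'.
Proof.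
move=> yS y'S /c2point_inj[z w].
have yy' : y = y'.
  by apply: (is_lift_inj (pt_lift k yS)); rewrite z w; exact: pt_lift.
split=> //; move: z w; rewrite -yy' => z w.
have : om ^+ k = om ^+ k'.
  have /orP[z0|w0] := is_lift_neq0 (fP yS).
    exact: (mulIf z0 z).
  exact: (mulIf w0 w).
move/eqP; rewrite (eq_prim_root_expr om_prim) !modn_small// => /eqP.
exact: val_inj.
Qed.

(** The design identity with the cardinality cleared from the denominator, as a double sum over base
    points and fibres. *)
Let good (p : mpoly 4 C) :=
  \sum_(y <- X) \sum_(k < s.+1) cpoly_eval p (pt y k) =
  (s.+1 * #|` X|%fset)%:R * sphere_mean p.

Let good_lin c d p q : good p -> good q -> good (c *: p + d *: q).
Proof.
move=> gp gq; rewrite /good.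
transitivity (c * (\sum_(y <- X) \sum_(k < s.+1) cpoly_eval p (pt y k)) +
    d * \sum_(y <- X) \sum_(k < s.+1) cpoly_eval q (pt y k)).
  rewrite !mulr_sumr -big_split /=; apply: eq_bigr => y _.
  rewrite !mulr_sumr -big_split /=; apply: eq_bigr => k _.
  by rewrite cpoly_evalD !cpoly_evalZ.
rewrite [X in c * X + _]gp [X in _ + d * X]gq sphere_meanD !sphere_meanZ [RHS]mulrDr.
by congr (_ + _); exact: mulrCA.
Qed.

Let mulr_scale_comb (P Q M Z : mpoly 4 C) (c d : C) :
  (c *: P + d *: Q) * M * Z = c *: (M * (P * Z)) + d *: (M * (Q * Z)).
Proof.
by rewrite !mulrDl -!scalerAl; congr (c *: _ + d *: _); rewrite -mulrA mulrCA.
Qed.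

Let design_sum (p : mpoly 3 C) : (mpoly.msize p <= t.+1)%N ->
  \sum_(y <- X) cpoly_eval p y = #|` X|%fset%:R * sphere_mean p.
Proof.
move=> pt1; case: dX => X0 _ /(_ p pt1) e.
by rewrite /sphere_mean -e mulrA divff ?mul1r// pnatr_eq0 cardfs_eq0.
Qed.

Let good_zmonom a a' b b' : (a + a' + b + b' <= s)%N -> good (zmonom R a a' b b').
Proof.
move=> deg; rewrite /good.
under eq_bigr do rewrite (sum_orbit_zmonom om_prim _ _ deg).
(* An unbalanced monomial sums to zero over every orbit and has mean zero on S^3. *)
have [ab|ab] := eqVneq (a + b)%N (a' + b')%N; last first.
  rewrite big1// sphere_mean_zmonom_neq ?mulr0//.
  by rewrite -negb_and; apply: contra ab => /andP[/eqP -> /eqP ->].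
rewrite -mulr_sumr -(sphere_mean_hopf_poly _ ab) natrM -mulrA; congr (_ * _).
rewrite -design_sum; last first.
  (* From 2(a + b) <= s <= 2t + 1 follows a + b <= t, for odd [s] too, so the design on S^2
     applies. *)
  by apply: leq_trans (msize_hopf_poly _ ab) _; lia.
apply: eq_big_seq => y yX; apply: is_lift_zmonom => //.
by apply: fP; case: dX => _ /(_ y yX).
Qed.

Let zmonom_z1 a a' b b' : zcoord R e0 e1 * zmonom R a a' b b' = zmonom R a.+1 a' b b'.
Proof. by rewrite /zmonom (mulrA (zcoord R e0 e1)); congr (_ * _); rewrite mulrA -exprS. Qed.

Let zmonom_w1 a a' b b' : zconj R e0 e1 * zmonom R a a' b b' = zmonom R a a'.+1 b b'.
Proof. by rewrite /zmonom (mulrA (zconj R e0 e1)); congr (_ * _); rewrite mulrCA -exprS. Qed.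

Let zmonom_z2 a a' b b' : zcoord R e2 e3 * zmonom R a a' b b' = zmonom R a a' b.+1 b'.
Proof. by rewrite /zmonom mulrCA; congr (_ * _); rewrite mulrA -exprS. Qed.

Let zmonom_w2 a a' b b' : zconj R e2 e3 * zmonom R a a' b b' = zmonom R a a' b b'.+1.
Proof. by rewrite /zmonom mulrCA; congr (_ * _); rewrite mulrCA -exprS. Qed.

Let half n (k l : 'I_n) : mX k = 2^-1 *: zcoord R k l + 2^-1 *: zconj R k l.
Proof.
rewrite -scalerDr addrACA subrr addr0 [X in _ *: X](_ : _ = 2 *: mX k).
  by rewrite scalerA mulVf ?scale1r// pnatr_eq0.
by rewrite scaler_nat mulr2n.
Qed.

Let half' n (k l : 'I_n) :
  mX l = (2 * 'i%C)^-1 *: zcoord R k l + (- (2 * 'i%C)^-1) *: zconj R k l.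
Proof.
have i0 : (2 * 'i%C : C) != 0.
  by rewrite mulf_neq0 ?pnatr_eq0// eq_complex/= oner_eq0 andbF.
rewrite scaleNr -scalerBr [X in _ *: X](_ : _ = (2 * 'i%C) *: mX l).
  by rewrite scalerA mulVf ?scale1r.
by rewrite /zcoord /zconj opprB [_ - mX k]addrC addrACA subrr add0r -scalerDl mulr_natl mulr2n.
Qed.

(** Real variables are traded one at a time for combinations of a complex coordinate and its
    conjugate. The total degree is kept while that of the real factor [m] drops, down to
    [good_zmonom]. *)
Let good_monom (m : mpoly.multinom 4) a a' b b' :
  (mpoly.mdeg m + a + a' + b + b' <= s)%N ->
  good (mpoly.mpolyX _ m * zmonom R a a' b b').
Proof.
have [n] := ubnP (mpoly.mdeg m); elim: n m a a' b b' => // n IH m a a' b b'.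
rewrite ltnS => mn deg.
have [/eqP m0|m0] := boolP (mpoly.mdeg m == 0%N).
  move: m0 deg => /eqP; rewrite mpoly.mdeg_eq0 => /eqP ->.
  rewrite mpoly.mpolyX0 mul1r mpoly.mdeg0 add0n; exact: good_zmonom.
have [i [m' mE]] : exists i m', m = mpoly.mnm_add (mpoly.mnm1 i) m'.
  have : [exists i, m i != 0%N].
    apply: contraNT m0; rewrite negb_exists => /forallP h.
    by rewrite mpoly.mdegE big1// => i _; apply/eqP; move: (h i); rewrite negbK.
  move=> /existsP[i mi]; exists i, (mpoly.mnm_sub m (mpoly.mnm1 i)).
  apply/mpoly.mnmP => j; rewrite mpoly.mnmDE mpoly.mnmBE mpoly.mnm1E.
  by case: eqVneq => [<-|]; lia.
move: mn deg; rewrite {m0}mE mpoly.mdegD mpoly.mdeg1 => mn deg.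
rewrite mpoly.mpolyXD.
have comb c d (P Q : mpoly 4 C) : mX i = c *: P + d *: Q ->
    good (mpoly.mpolyX _ m' * (P * zmonom R a a' b b')) ->
    good (mpoly.mpolyX _ m' * (Q * zmonom R a a' b b')) ->
    good (mX i * mpoly.mpolyX _ m' * zmonom R a a' b b').
  move=> e gP gQ; have := good_lin c d gP gQ.
  by rewrite -(mulr_scale_comb P Q (mpoly.mpolyX _ m') (zmonom R a a' b b')) -e.
have [i01|i23] : (i = e0 \/ i = e1) \/ (i = e2 \/ i = e3).
- case: (i) => -[|[|[|[|//]]]] k4.
  + by left; left; exact/val_inj.
  + by left; right; exact/val_inj.
  + by right; left; exact/val_inj.
  + by right; right; exact/val_inj.
- have [c [d cd]] : exists c d, mX i = c *: zcoord R e0 e1 + d *: zconj R e0 e1.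
    by case: i01 => ->; do 2 eexists; [exact: half|exact: half'].
  by apply: (comb _ _ _ _ cd); rewrite ?zmonom_z1 ?zmonom_w1; apply: IH; lia.
- have [c [d cd]] : exists c d, mX i = c *: zcoord R e2 e3 + d *: zconj R e2 e3.
    by case: i23 => ->; do 2 eexists; [exact: half|exact: half'].
  by apply: (comb _ _ _ _ cd); rewrite ?zmonom_z2 ?zmonom_w2; apply: IH; lia.
Qed.

Let good_poly (p : mpoly 4 C) : (mpoly.msize p <= s.+1)%N -> good p.
Proof.
move=> ps; rewrite /good (mpoly.mpolyE p) sphere_mean_sum mulr_sumr.
transitivity (\sum_(m <- mpoly.msupp p) \sum_(y <- X) \sum_(k < s.+1)
    cpoly_eval (mpoly.mcoeff m p *: mpoly.mpolyX _ m) (pt y k)).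
  rewrite [RHS]exchange_big /=; apply: eq_bigr => y _.
  rewrite [RHS]exchange_big /=; apply: eq_bigr => k _.
  by rewrite /cpoly_eval (rmorph_sum (mpoly.meval _)).
apply: eq_big_seq => m /mpoly.msize_mdeg_lt ms.
have : good (mpoly.mpolyX _ m).
  rewrite -[X in good X]mulr1 -[X in _ * X](_ : zmonom R 0 0 0 0 = 1).
    by apply: good_monom; rewrite !addn0; exact: leq_trans ms ps.
  by rewrite /zmonom !expr0 !mulr1.
rewrite /good => gm; transitivity (mpoly.mcoeff m p *
    ((s.+1 * #|` X|%fset)%:R * sphere_mean (mpoly.mpolyX C m))); last first.
  by rewrite sphere_meanZ; exact: mulrCA.
rewrite -[X in _ * X]gm mulr_sumr; apply: eq_bigr => y _; rewrite mulr_sumr; apply: eq_bigr => k _.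
by rewrite cpoly_evalZ.
Qed.

Lemma lift_design : exists2 Y : {fset euclid R 4}, is_design s Y &
  #|` Y|%fset = (s.+1 * #|` X|%fset)%N.
Proof.
have [X0 XS _] := dX.
pose g y (k : 'I_s.+1) := pt y k.
pose l := [seq g y k | y <- X, k <- enum 'I_s.+1].
(* Without repetitions, the sum over the set is the double sum of [good], and the cardinality is the
   full product. *)
have l_uniq : uniq l.
  apply: allpairs_uniq_dep => [|y _|[y k] [y' k']]; [exact: fset_uniq|exact: enum_uniq|].
  move=> /allpairsPdep[y1 [k1 [y1X _ e]]] /allpairsPdep[y2 [k2 [y2X _ e']]].
  case: e => ? ?; case: e' => ? ?; subst y1 k1 y2 k2 => /=.
  by move/(pt_inj (XS _ y1X) (XS _ y2X)) => [-> ->].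
have l_perm : perm_eq (seq_fset tt l) l.
  by apply: perm_trans (seq_fset_perm tt l) _; rewrite undup_id.
have l_card : #|` seq_fset tt l|%fset = (s.+1 * #|` X|%fset)%N.
  by rewrite size_seq_fset undup_id// size_allpairs size_enum_ord mulnC.
exists (seq_fset tt l) => //; split.
- by rewrite -cardfs_eq0 l_card muln_eq0 /= cardfs_eq0.
- move=> x; rewrite seq_fsetE => /allpairsP[[y k] [yX _ ->]].
  exact: (is_lift_sphere (pt_lift k (XS _ yX))).
- move=> p ps; rewrite (perm_big _ l_perm) l_card.
  rewrite big_allpairs_dep /=.
  under eq_bigr do rewrite big_enum.
  rewrite [X in _ * X](good_poly ps) mulrA mulVf ?mul1r//.
  by rewrite pnatr_eq0 muln_eq0 /= cardfs_eq0.
Qed.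

End lift_design.

(** * Bounds on the minimal size of designs *)

Lemma min_design_hopf (R : realType) (s t : nat) : (s <= 2 * t + 1)%N ->
  (min_design R 3 s <= (s.+1%:R)%:E * min_design R 2 t)%E.
Proof.
(* Without a t-design on S^2 the right-hand side is +oo. *)
move=> st; have [[X dX]|noX] := pselect (exists X, @is_design R 2 t X); last first.
  rewrite [in leRHS]/min_design [X in ereal_inf X](_ : _ = set0).
    by rewrite ereal_inf0 gt0_muley ?leey// lte_fin.
  by apply/seteqP; split => // u [X dX _]; exfalso; apply: noX; exists X.
have [Y dY ->] := min_designP dX.
have [om om_prim] := complex_prim_root_exists R (ltn0Sn s).
have lift_ex (y : euclid R 3) : exists zw : R[i] * R[i],
    sphere y -> is_lift y zw.1 zw.2.
  (* Off the sphere the value is arbitrary; it only makes the choice of lifts total. *)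
  have [yS|nS] := pselect (sphere y); last by exists (0, 0).
  by have [z [w zw]] := exists_lift yS; exists (z, w).
have [f fP] := boolp.choice lift_ex.
have [Z dZ cZ] := lift_design om_prim dY st fP.
rewrite -EFinM -natrM -cZ; apply: ereal_inf_lbound.
by exists Z.
Qed.

Local Open Scope ereal_scope.

Theorem mainTheorem2 (R : realType) (t : nat) :
  min_design R 3 (2 * t) <= ((2 * t + 1)%:R)%:E * min_design R 2 t /\
  min_design R 3 (2 * t + 1) <= ((2 * (t + 1))%:R)%:E * min_design R 2 t.
Proof.
split; first by rewrite [(2 * t + 1)%N]addn1; apply: min_design_hopf; rewrite leq_addr.
have -> : (2 * (t + 1))%N = (2 * t + 1).+1 by lia.
exact: min_design_hopf.
Qed.
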